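(* Assume that the Lie algebra $\mathfrak{g}$ is unimodular (i.e. $\mathrm{tr}(\mathrm{ad}_\xi)=0$ for all $\xi\in\mathfrak{g}$) and that the Lie group $\mathfrak{G}$ is compact. Let $\boldsymbol{\eta}=\boldsymbol{\eta}_a\beta^a+t_i\gamma^i$ be a smooth normalized $\mathfrak{g}$-valued 1-form (with $\mathfrak{g}$-valued functions $\boldsymbol{\eta}_a$, $1\le a\le n$) and let $\boldsymbol{p}^{ab}=-\boldsymbol{p}^{ba}$ ($1\le a,b\le n$) and $\boldsymbol{p}^{aj}$ ($1\le a\le n$, $1\le j\le r$) be smooth $\mathfrak{g}^*$-valued functions on the total space $\mathcal{P}$. No equivariance of these fields is assumed a priori. Suppose they satisfy, for all $a,b\in\{1,\dots,n\}$ and $j\in\{1,\dots,r\}$, with summation over repeated indices (over $b$ and $j$ in the third equation), $$ \left\{\begin{array}{rcl} \boldsymbol{\eta}_{b;a}-\boldsymbol{\eta}_{a;b}+[\boldsymbol{\eta}_a,\boldsymbol{\eta}_b] &=& \textsf{h}^*\boldsymbol{p}_{ab},\\ \boldsymbol{\eta}_{a;j}+[t_j,\boldsymbol{\eta}_a] &=& 0,\\ \boldsymbol{p}^{ab}_{;b}-\mathrm{ad}^*_{\boldsymbol{\eta}_b}(\boldsymbol{p}^{ab})+\boldsymbol{p}^{aj}_{;j}-\mathrm{ad}^*_{t_j}(\boldsymbol{p}^{aj})-\mathrm{tr}(\mathrm{ad}_{t_j})\,\boldsymbol{p}^{aj} &=& 0. \end{array}\right. $$ Then $\boldsymbol{\eta}$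 is a solution of the classical Yang--Mills equations, i.e. the curvature components $\boldsymbol{F}_{ab}:=\boldsymbol{\eta}_{b;a}-\boldsymbol{\eta}_{a;b}+[\boldsymbol{\eta}_a,\boldsymbol{\eta}_b]$ satisfy $$\boldsymbol{F}^{ab}_{;b}+[\boldsymbol{\eta}_b,\boldsymbol{F}^{ab}]=0\qquad\text{for all } a=1,\dots,n .$$
   Context: Setting. $\mathcal{M}$ is an $n$-dimensional manifold with a pseudo-Riemannian metric $\textsf{g}$; $\mathfrak{G}$ is a Lie group of matrices of dimension $r$ with Lie algebra $\mathfrak{g}$, dual $\mathfrak{g}^*$ and basis $(t_1,\dots,t_r)$ of $\mathfrak g$; $\textsf{h}=(\textsf{h}_{ij})$ is a (nondegenerate) metric on $\mathfrak{g}$ invariant under the adjoint action of $\mathfrak{G}$. $\pi_{\mathcal M}:\mathcal{P}\to\mathcal{M}$ is a principal bundle with structure group $\mathfrak{G}$ acting on the right. Frames. $\rho_j$ is the vector field on $\mathcal P$ given by $\rho_j(z)=\frac{d}{dt}(z\cdot e^{t t_j})|_{t=0}$. One chooses a (local) orthonormal frame $(\underline e_1,\dots,\underline e_n)$ of $T\mathcal{M}$ (so that $\textsf{g}_{ab}:=\textsf{g}(\underline e_a,\underline e_b)$ are constants, with inverse matrix $\textsf{g}^{ab}$) and a (local) section $\boldsymbol\sigma$ of $\mathcal{P}$, which identifies $z=\boldsymbol\sigma(x)\cdot g\in\mathcal P$ with $(x,g)$. One sets $e_a(z)=d(R_g\circ\boldsymbol\sigma)_x(\underline e_a(x))$ for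 $z=\boldsymbol\sigma(x)\cdot g$, where $R_g(z)=z\cdot g$. (If the section and frame are only defined over an open subset of $\mathcal M$, everything is understood over that subset, i.e. on the part of $\mathcal P$ lying over it, which is a union of whole fibres.) $(\beta^1,\dots,\beta^n,\gamma^1,\dots,\gamma^r)$ is the coframe on $\mathcal P$ dual to $(e_1,\dots,e_n,\rho_1,\dots,\rho_r)$. A $\mathfrak{g}$-valued 1-form $\boldsymbol\eta$ on $\mathcal P$ is normalized if $\boldsymbol\eta_z(z\cdot\xi)=\xi$ for all $z\in\mathcal P$, $\xi\in\mathfrak g$ (where $z\cdot\xi=\frac{d}{dt}(z\cdot e^{t\xi})|_{t=0}$), equivalently $\boldsymbol\eta=\boldsymbol\eta_a\beta^a+t_i\gamma^i$. Derivatives. $\omega^b_a$ are the connection 1-forms of the Levi-Civita connection $\underline\nabla$ of $\textsf{g}$ in the frame $(\underline e_a)$, $\underline\nabla_{\underline e_a}\underline e_b=\omega^c_b(\underline e_a)\underline e_c$, pulled back to $\mathcal P$ by $\pi_{\mathcal M}$. The semicolon denotes: $\boldsymbol\eta_{b;a}=(d\boldsymbol\eta_b-\boldsymbol\eta_c\,\omega^c_b)(e_a)$; $\boldsymbol\eta_{a;j}=d\boldsymbol\eta_a(\rho_j)$; $\boldsymbol p^{ab}_{;c}=(d\boldsymbol p^{ab}+\boldsymbol p^{db}\omega^a_d+\boldsymbol p^{ad}\omega^b_d)(e_c)$; $\boldsymbol p^{aj}_{;k}=d\boldsymbol p^{aj}(\rho_k)$; and $\boldsymbol F^{ab}_{;c}$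 is defined by the same formula as $\boldsymbol p^{ab}_{;c}$. Algebra. Indices $a,b$ are raised and lowered with $\textsf{g}$: $\boldsymbol p_{ab}=\textsf{g}_{ac}\textsf{g}_{bd}\boldsymbol p^{cd}$, $\boldsymbol F^{ab}=\textsf{g}^{ac}\textsf{g}^{bd}\boldsymbol F_{cd}$. $\textsf{h}^*:\mathfrak g^*\to\mathfrak g$ is the inverse of the isomorphism $\textsf{h}_*:\mathfrak g\to\mathfrak g^*$, $(\textsf{h}_*\xi)(\zeta)=\textsf{h}_{ij}\xi^i\zeta^j$. $\mathrm{ad}_\xi(\zeta)=[\xi,\zeta]$, and $\mathrm{ad}^*_\xi:\mathfrak g^*\to\mathfrak g^*$ is its transpose, $(\mathrm{ad}_\xi^*\ell)(\zeta)=\ell([\xi,\zeta])$. The second equation of the system is the infinitesimal equivariance of $\boldsymbol\eta$ under the action of $\mathfrak G$; for such $\boldsymbol\eta$ the displayed Yang--Mills equation on $\mathcal P$ is the Yang--Mills equation of the associated connection. *)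

(* Defs.v *)
From HB Require Import structures.
From mathcomp Require Import all_boot all_order all_algebra.
From mathcomp Require Import all_classical all_reals all_analysis.

Set Implicit Arguments.
Unset Strict Implicit.
Unset Printing Implicit Defensive.

Import Order.TTheory GRing.Theory Num.Theory numFieldNormedType.Exports.

Local Open Scope classical_set_scope.
Local Open Scope ring_scope.

(* C^k and C^oo maps on an open subset U of a normed space.  The normed spaces
   used below are finite-dimensional, where requiring all directional
   derivatives to be C^k is the usual notion of a C^(k+1) map. *)
Fixpoint Ck (R : realType) (V W : normedModType R) (k : nat) (U : set V)
    (f : V -> W) : Prop :=
  match k with
  | 0 => forall x, U x -> {for x, continuous f}
  | k'.+1 => (forall x, U x -> differentiable f x) /\
             (forall v : V, Ck k' U ('D_v f))
  end.

Definition smooth_on (R : realType) (V W : normedModType R) (U : set V)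
    (f : V -> W) : Prop := forall k, Ck k U f.

(* The atlas is indexed by the points of M: [chart x] is a chart around x, with
   domain [chart_dom x] and inverse [chart_inv x].  Only the values of [chart x]
   on its domain and of [chart_inv x] on the image of the domain matter. *)
Record smooth_manifold (R : realType) (n : nat) (M : topologicalType) := {
  chart_dom : M -> set M;
  chart : M -> M -> 'rV[R]_n;
  chart_inv : M -> 'rV[R]_n -> M;
  chart_dom_open : forall x, open (chart_dom x);
  mem_chart_dom : forall x, chart_dom x x;
  chart_img_open : forall x, open (chart x @` chart_dom x);
  chartK : forall x y, chart_dom x y -> chart_inv x (chart x y) = y;
  chart_continuous : forall x y, chart_dom x y -> {for y, continuous (chart x)};
  chart_inv_continuous : forall x u, (chart x @` chart_dom x) u ->
    {for u, continuous (chart_inv x)};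
  chart_transition : forall x y,
    smooth_on (chart x @` (chart_dom x `&` chart_dom y))
              (chart y \o chart_inv x);
  manifold_hausdorff : hausdorff_space M;
  manifold_second_countable : @second_countable M }.

Definition msmooth (R : realType) (n : nat) (M : topologicalType)
    (A : smooth_manifold R n M) (W : normedModType R) (U : set M)
    (f : M -> W) : Prop :=
  forall x, U x -> exists D : set 'rV[R]_n,
    [/\ open D, D (chart A x x) & smooth_on D (f \o chart_inv A x)].

(* The tangent space at x is identified with R^n through the chart [chart x]
   attached to x, so that a vector field is a map M -> 'rV[R]_n;
   [mder f x v] is df_x(v). *)
Definition mder (R : realType) (n : nat) (M : topologicalType)
    (A : smooth_manifold R n M) (W : normedModType R)
    (f : M -> W) (x : M) (v : 'rV[R]_n) : W :=
  'D_v (f \o chart_inv A x) (chart A x x).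

(* [mder (chart x) y (X y)] is the vector of components of X(y) in the fixed
   chart [chart x]. *)
Definition smooth_vf (R : realType) (n : nat) (M : topologicalType)
    (A : smooth_manifold R n M) (U : set M) (X : M -> 'rV[R]_n) : Prop :=
  forall x, msmooth A (U `&` chart_dom A x)
                    (fun y => mder A (chart A x) y (X y)).

Record pseudo_metric (R : realType) (n : nat) (M : topologicalType)
    (A : smooth_manifold R n M) := {
  gram : M -> 'M[R]_n;
  gram_sym : forall x, (gram x)^T = gram x;
  gram_nondeg : forall x, gram x \in unitmx;
  gram_smooth : forall (U : set M) (X Y : M -> 'rV[R]_n), open U ->
    smooth_vf A U X -> smooth_vf A U Y ->
    msmooth A U (fun x => (X x *m gram x *m (Y x)^T) 0 0 : R) }.

Definition gdot (R : realType) (n : nat) (M : topologicalType)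
    (A : smooth_manifold R n M) (gM : pseudo_metric A) (x : M)
    (u v : 'rV[R]_n) : R := (u *m gram gM x *m v^T) 0 0.

(* Z = [X, Y] on U, the bracket acting on functions as the commutator *)
Definition is_vf_bracket (R : realType) (n : nat) (M : topologicalType)
    (A : smooth_manifold R n M) (U : set M) (X Y Z : M -> 'rV[R]_n) : Prop :=
  forall f : M -> R, msmooth A U f -> forall x, U x ->
    mder A f x (Z x) = mder A (fun y => mder A f y (Y y)) x (X x)
                     - mder A (fun y => mder A f y (X y)) x (Y x).

(* nabla X Y is the derivative of Y along X. *)
Record levi_civita (R : realType) (n : nat) (M : topologicalType)
    (A : smooth_manifold R n M) (gM : pseudo_metric A) (U : set M)
    (nabla : (M -> 'rV[R]_n) -> (M -> 'rV[R]_n) -> M -> 'rV[R]_n) : Prop := {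
  lc_smooth : forall X Y, smooth_vf A U X -> smooth_vf A U Y ->
    smooth_vf A U (nabla X Y);
  lc_addl : forall X X' Y, smooth_vf A U X -> smooth_vf A U X' ->
    smooth_vf A U Y -> forall x, U x ->
    nabla (fun y => X y + X' y) Y x = nabla X Y x + nabla X' Y x;
  lc_scalel : forall (f : M -> R) X Y, msmooth A U f -> smooth_vf A U X ->
    smooth_vf A U Y -> forall x, U x ->
    nabla (fun y => f y *: X y) Y x = f x *: nabla X Y x;
  lc_addr : forall X Y Y', smooth_vf A U X -> smooth_vf A U Y ->
    smooth_vf A U Y' -> forall x, U x ->
    nabla X (fun y => Y y + Y' y) x = nabla X Y x + nabla X Y' x;
  lc_leibniz : forall (f : M -> R) X Y, msmooth A U f -> smooth_vf A U X ->
    smooth_vf A U Y -> forall x, U x ->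
    nabla X (fun y => f y *: Y y) x
      = mder A f x (X x) *: Y x + f x *: nabla X Y x;
  lc_metric : forall X Y Z, smooth_vf A U X -> smooth_vf A U Y ->
    smooth_vf A U Z -> forall x, U x ->
    mder A (fun y => gdot gM y (Y y) (Z y) : R) x (X x)
      = gdot gM x (nabla X Y x) (Z x) + gdot gM x (Y x) (nabla X Z x);
  lc_torsion : forall X Y, smooth_vf A U X -> smooth_vf A U Y ->
    is_vf_bracket A U X Y (fun x => nabla X Y x - nabla Y X x) }.

Definition mexp (R : realType) (N : nat) (X : 'M[R]_N) : 'M[R]_N :=
  lim (series (fun k => (k`!%:R)^-1 *: X ^+ k) @ \oo).

(* A Lie group of matrices: a closed subgroup of GL_N(R).  Complex matrix groups
   are covered through the embedding of GL_N(C) in GL_2N(R). *)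
Record matrix_lie_group (R : realType) (N r : nat) := {
  lgrp : set 'M[R]_N;
  grp_unit : forall g, lgrp g -> g \in unitmx;
  grp1 : lgrp 1%:M;
  grpM : forall g k, lgrp g -> lgrp k -> lgrp (g *m k);
  grpV : forall g, lgrp g -> lgrp (invmx g);
  grp_closed : forall g, g \in unitmx -> closure lgrp g -> lgrp g;
  lalg : {vspace 'M[R]_N};
  lieE : forall X : 'M[R]_N,
    X \in lalg <-> (forall s : R, lgrp (mexp (s *: X)));
  tbasis : r.-tuple 'M[R]_N;
  tbasisP : basis_of lalg tbasis }.

Definition tb (R : realType) (N r : nat) (G : matrix_lie_group R N r)
    (j : 'I_r) : 'M[R]_N := tnth (tbasis G) j.

Definition brk (R : realType) (N : nat) (X Y : 'M[R]_N) : 'M[R]_N :=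
  X *m Y - Y *m X.

Definition lcoord (R : realType) (N r : nat) (G : matrix_lie_group R N r)
    (X : 'M[R]_N) : 'rV[R]_r := \row_i coord (tbasis G) i X.

Definition ad_mx (R : realType) (N r : nat) (G : matrix_lie_group R N r)
    (X : 'M[R]_N) : 'M[R]_r :=
  \matrix_(i, j) coord (tbasis G) i (brk X (tb G j)).

Definition unimodular (R : realType) (N r : nat) (G : matrix_lie_group R N r)
  : Prop := forall X, X \in lalg G -> \tr (ad_mx G X) = 0.

(* Elements l of the dual of the Lie algebra are represented by their components
   l_i = l(t_i) in the basis dual to (t_i). *)
Definition dual_eval (R : realType) (N r : nat) (G : matrix_lie_group R N r)
    (l : 'rV[R]_r) (X : 'M[R]_N) : R := \sum_i l 0 i * lcoord G X 0 i.

Definition ad_star (R : realType) (N r : nat) (G : matrix_lie_group R N r)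
    (X : 'M[R]_N) (l : 'rV[R]_r) : 'rV[R]_r :=
  \row_i dual_eval G l (brk X (tb G i)).

Definition hform (R : realType) (N r : nat) (G : matrix_lie_group R N r)
    (h : 'M[R]_r) (X Y : 'M[R]_N) : R :=
  \sum_i \sum_j h i j * lcoord G X 0 i * lcoord G Y 0 j.

Record Ad_invariant_metric (R : realType) (N r : nat)
    (G : matrix_lie_group R N r) (h : 'M[R]_r) : Prop := {
  hmet_sym : h^T = h;
  hmet_nondeg : h \in unitmx;
  hmet_Ad : forall g X Y, lgrp G g -> X \in lalg G -> Y \in lalg G ->
    hform G h (g *m X *m invmx g) (g *m Y *m invmx g) = hform G h X Y }.

(* h_* maps X, with components X^i, to l_j = X^i h_ij; [h_sharp] is its
   inverse. *)
Definition h_sharp (R : realType) (N r : nat) (G : matrix_lie_group R N r)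
    (h : 'M[R]_r) (l : 'rV[R]_r) : 'M[R]_N :=
  \sum_i (l *m invmx h) 0 i *: tb G i.

(* A principal bundle is given by a free right action whose orbits are the
   fibres of [pb_proj], and by local sections [lsec x] around each x in M which
   differ by smooth G-valued functions.  The smooth structure of P is the one
   making all the trivializations (y, g) |-> lsec x y . g diffeomorphisms (see
   [psmooth] below). *)
Record principal_bundle (R : realType) (n N r : nat) (M : topologicalType)
    (A : smooth_manifold R n M) (G : matrix_lie_group R N r) (P : Type) := {
  pb_proj : P -> M;
  pb_act : P -> 'M[R]_N -> P;
  pb_act1 : forall z, pb_act z 1%:M = z;
  pb_actM : forall z g k, lgrp G g -> lgrp G k ->
    pb_act (pb_act z g) k = pb_act z (g *m k);
  act_free : forall z g k, lgrp G g -> lgrp G k ->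
    pb_act z g = pb_act z k -> g = k;
  act_proj : forall z g, lgrp G g -> pb_proj (pb_act z g) = pb_proj z;
  act_trans : forall z w, pb_proj z = pb_proj w ->
    exists2 g, lgrp G g & w = pb_act z g;
  lsec_dom : M -> set M;
  lsec : M -> M -> P;
  lsec_dom_open : forall x, open (lsec_dom x);
  mem_lsec_dom : forall x, lsec_dom x x;
  lsecK : forall x y, lsec_dom x y -> pb_proj (lsec x y) = y;
  lsec_transition : forall x x', exists2 tau : M -> 'M[R]_N,
    msmooth A (lsec_dom x `&` lsec_dom x') tau &
    forall y, lsec_dom x y -> lsec_dom x' y ->
      lgrp G (tau y) /\ lsec x' y = pb_act (lsec x y) (tau y) }.

Definition smooth_section (R : realType) (n N r : nat) (M : topologicalType)
    (A : smooth_manifold R n M) (G : matrix_lie_group R N r) (P : Type)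
    (B : principal_bundle A G P) (U : set M) (s : M -> P) : Prop :=
  (forall y, U y -> pb_proj B (s y) = y) /\
  forall x, exists2 tau : M -> 'M[R]_N,
    msmooth A (U `&` lsec_dom B x) tau &
    forall y, U y -> lsec_dom B x y ->
      lgrp G (tau y) /\ s y = pb_act B (lsec B x y) (tau y).

(* Smoothness of f on the part of P over O: in each local trivialization
   (y, g) |-> s y . g, f is locally the restriction to the submanifold G of
   matrix space of a smooth function of (y, g). *)
Definition psmooth (R : realType) (n N r : nat) (M : topologicalType)
    (A : smooth_manifold R n M) (G : matrix_lie_group R N r) (P : Type)
    (B : principal_bundle A G P) (W : normedModType R) (O : set M)
    (f : P -> W) : Prop :=
  forall (U : set M) (s : M -> P), open U -> U `<=` O ->
    smooth_section B U s ->
    forall x g, U x -> lgrp G g ->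
      exists (D : set ('rV[R]_n * 'M[R]_N)) (F : 'rV[R]_n * 'M[R]_N -> W),
        [/\ open D, D (chart A x x, g), smooth_on D F &
          forall u k, D (u, k) -> lgrp G k ->
            f (pb_act B (s (chart_inv A x u)) k) = F (u, k)].

(* A local orthonormal frame of TM and a local section of P, over the open
   set O. [gconst] is the constant matrix (g_ab). *)
Record adapted_frame (R : realType) (n N r : nat) (M : topologicalType)
    (A : smooth_manifold R n M) (gM : pseudo_metric A)
    (G : matrix_lie_group R N r) (P : Type) (B : principal_bundle A G P)
    (O : set M) := {
  frm : 'I_n -> M -> 'rV[R]_n;
  frm_smooth : forall a, smooth_vf A O (frm a);
  gconst : 'M[R]_n;
  gconst_diag : forall a, gconst a a = 1 \/ gconst a a = -1;
  gconst_offdiag : forall a b, a != b -> gconst a b = 0;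
  frm_orthonormal : forall a b x, O x ->
    gdot gM x (frm a x) (frm b x) = gconst a b;
  frm_sec : M -> P;
  sec_smooth : smooth_section B O frm_sec }.

(* om c b is the connection 1-form omega^c_b. *)
Definition connection_forms (R : realType) (n N r : nat) (M : topologicalType)
    (A : smooth_manifold R n M) (gM : pseudo_metric A)
    (G : matrix_lie_group R N r) (P : Type) (B : principal_bundle A G P)
    (O : set M) (F : adapted_frame gM B O)
    (om : 'I_n -> 'I_n -> M -> {scalar 'rV[R]_n}) : Prop :=
  exists2 nabla, levi_civita gM O nabla &
    forall a b x, O x ->
      nabla (frm F a) (frm F b) x = \sum_c om c b x (frm F a x) *: frm F c x.

(* The section sigma identifies z = sigma(x) . g with (x, g); a tangent vector
   of P at z is identified with the pair (v, X) in T_xM x Lie(G) such that it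
   equals d(R_g o sigma)_x(v) + z . X. *)
Definition tangentP (R : realType) (n N r : nat) (G : matrix_lie_group R N r) :=
  ('rV[R]_n * subvs_of (lalg G))%type.

Definition gpart (R : realType) (n N r : nat) (M : topologicalType)
    (A : smooth_manifold R n M) (G : matrix_lie_group R N r) (P : Type)
    (B : principal_bundle A G P) (s : M -> P) (z : P) : 'M[R]_N :=
  get [set g | lgrp G g /\ z = pb_act B (s (pb_proj B z)) g].

(* df_z(w) *)
Definition dP (R : realType) (n N r : nat) (M : topologicalType)
    (A : smooth_manifold R n M) (gM : pseudo_metric A)
    (G : matrix_lie_group R N r) (P : Type) (B : principal_bundle A G P)
    (O : set M) (F : adapted_frame gM B O) (W : normedModType R)
    (f : P -> W) (z : P) (w : tangentP n G) : W :=
  mder A (fun y => f (pb_act B (frm_sec F y) (gpart B (frm_sec F) z)))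
       (pb_proj B z) w.1
  + derive1 (fun s : R => f (pb_act B z (mexp (s *: vsval w.2)))) 0.

Definition eP (R : realType) (n N r : nat) (M : topologicalType)
    (A : smooth_manifold R n M) (gM : pseudo_metric A)
    (G : matrix_lie_group R N r) (P : Type) (B : principal_bundle A G P)
    (O : set M) (F : adapted_frame gM B O) (a : 'I_n) (z : P) : tangentP n G :=
  (frm F a (pb_proj B z), 0).

(* z . X; it does not depend on z in the trivialization *)
Definition fundP (R : realType) (n N r : nat) (G : matrix_lie_group R N r)
    (X : subvs_of (lalg G)) : tangentP n G := (0, X).

Definition rhoP (R : realType) (n N r : nat) (G : matrix_lie_group R N r)
    (j : 'I_r) : tangentP n G := fundP n (vsproj (lalg G) (tb G j)).

(* the pull-back of a 1-form on M by the projection of P *)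
Definition pullP (R : realType) (n N r : nat) (M : topologicalType)
    (A : smooth_manifold R n M) (G : matrix_lie_group R N r) (P : Type)
    (B : principal_bundle A G P) (al : M -> {scalar 'rV[R]_n}) (z : P)
    (w : tangentP n G) : R := al (pb_proj B z) w.1.

Definition lie_1form (R : realType) (n N r : nat) (G : matrix_lie_group R N r)
    (P : Type) := P -> {linear tangentP n G -> subvs_of (lalg G)}.

Definition normalized (R : realType) (n N r : nat) (M : topologicalType)
    (A : smooth_manifold R n M) (G : matrix_lie_group R N r) (P : Type)
    (B : principal_bundle A G P) (O : set M) (eta : lie_1form n G P) : Prop :=
  forall z X, O (pb_proj B z) -> eta z (fundP n X) = X.

(* eta_a, the coefficient of beta^a in eta *)
Definition form_comp (R : realType) (n N r : nat) (M : topologicalType)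
    (A : smooth_manifold R n M) (gM : pseudo_metric A)
    (G : matrix_lie_group R N r) (P : Type) (B : principal_bundle A G P)
    (O : set M) (F : adapted_frame gM B O) (eta : lie_1form n G P)
    (a : 'I_n) (z : P) : 'M[R]_N := vsval (eta z (eP F a z)).

Definition smooth_1form (R : realType) (n N r : nat) (M : topologicalType)
    (A : smooth_manifold R n M) (gM : pseudo_metric A)
    (G : matrix_lie_group R N r) (P : Type) (B : principal_bundle A G P)
    (O : set M) (F : adapted_frame gM B O) (eta : lie_1form n G P) : Prop :=
  (forall a, psmooth B O (form_comp F eta a)) /\
  (forall j, psmooth B O (fun z => vsval (eta z (rhoP n G j)) : 'M[R]_N)).

(* u_{b;a} *)
Definition covD1 (R : realType) (n N r : nat) (M : topologicalType)
    (A : smooth_manifold R n M) (gM : pseudo_metric A)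
    (G : matrix_lie_group R N r) (P : Type) (B : principal_bundle A G P)
    (O : set M) (F : adapted_frame gM B O)
    (om : 'I_n -> 'I_n -> M -> {scalar 'rV[R]_n}) (W : normedModType R)
    (u : 'I_n -> P -> W) (b a : 'I_n) (z : P) : W :=
  dP F (u b) z (eP F a z) - \sum_c pullP B (om c b) z (eP F a z) *: u c z.

(* T^{ab}_{;c} *)
Definition covD2 (R : realType) (n N r : nat) (M : topologicalType)
    (A : smooth_manifold R n M) (gM : pseudo_metric A)
    (G : matrix_lie_group R N r) (P : Type) (B : principal_bundle A G P)
    (O : set M) (F : adapted_frame gM B O)
    (om : 'I_n -> 'I_n -> M -> {scalar 'rV[R]_n}) (W : normedModType R)
    (T : 'I_n -> 'I_n -> P -> W) (a b c : 'I_n) (z : P) : W :=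
  dP F (T a b) z (eP F c z)
  + \sum_d pullP B (om a d) z (eP F c z) *: T d b z
  + \sum_d pullP B (om b d) z (eP F c z) *: T a d z.

Definition transvect2 (R : realType) (n : nat) (S : 'M[R]_n) (P : Type)
    (W : normedModType R) (T : 'I_n -> 'I_n -> P -> W) (a b : 'I_n) (z : P)
  : W := \sum_c \sum_d (S a c * S b d) *: T c d z.

Definition lower2 (R : realType) (n : nat) (g : 'M[R]_n) (P : Type)
    (W : normedModType R) (T : 'I_n -> 'I_n -> P -> W) :=
  transvect2 g T.

Definition raise2 (R : realType) (n : nat) (g : 'M[R]_n) (P : Type)
    (W : normedModType R) (T : 'I_n -> 'I_n -> P -> W) :=
  transvect2 (invmx g) T.

(* F_ab *)
Definition curv (R : realType) (n N r : nat) (M : topologicalType)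
    (A : smooth_manifold R n M) (gM : pseudo_metric A)
    (G : matrix_lie_group R N r) (P : Type) (B : principal_bundle A G P)
    (O : set M) (F : adapted_frame gM B O)
    (om : 'I_n -> 'I_n -> M -> {scalar 'rV[R]_n}) (eta : lie_1form n G P)
    (a b : 'I_n) (z : P) : 'M[R]_N :=
  covD1 F om (form_comp F eta) b a z - covD1 F om (form_comp F eta) a b z
  + brk (form_comp F eta a z) (form_comp F eta b z).

(* Main.v *)
(** With F^{ab} = h^* p^{ab} and unimodularity, the third equation says that the
    Yang-Mills residue E^a = F^{ab}_{;b} + [eta_b, F^{ab}] is minus a divergence
    along the fibre: transported to the Lie algebra by Ad_k,
    Ad_k E^a(sigma(x).k) = - sum_j rho_j Q_j(k)  with
    Q_j(k) = Ad_k h^* p^{aj}(sigma(x).k).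
    The second equation integrates to equivariance of eta under the one-parameter
    groups of the t_j, so that the left-hand side is invariant under them.  A
    constant divergence on a compact group vanishes.  Instead of integrating
    against Haar measure, the continuous functions rho_j Q_j are averaged over
    finitely many left translates until they are almost constant; since each is
    the derivative of a bounded function along a flow, it is then almost 0. *)

Require Import Defs.
From HB Require Import structures.
From mathcomp Require Import all_boot all_order all_algebra.
From mathcomp Require Import all_classical all_reals all_analysis.
From mathcomp Require Import ring lra.
Import Order.TTheory GRing.Theory Num.Theory numFieldNormedType.Exports.
Local Open Scope classical_set_scope.
Local Open Scope ring_scope.

Set Implicit Arguments.
Unset Strict Implicit.
Unset Printing Implicit Defensive.

(** * Averages over left translates on a compact group *)

Section MatrixLimits.
Variables (R : realType) (T : Type) (F : set_system T).
Context {FF : Filter F}.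

Lemma cvg_mxP m n (f : T -> 'M[R]_(m, n)) (l : 'M[R]_(m, n)) :
  f x @[x --> F] --> l <-> forall i j, f x i j @[x --> F] --> l i j.
Proof.
split=> [fl i j|fl].
  have := @coord_continuous R m n i j l; exact: cvg_comp.
apply/cvgrPdist_le => /= e e0; near=> x.
rewrite /Num.Def.normr/= mx_normrE (bigmax_le _ (ltW e0))//= => -[i j] _.
rewrite !mxE/=; move: i j; near: x; apply: filter_forall => i; apply: filter_forall => j.
by have /cvgrPdist_le := fl i j; exact.
Unshelve. all: by end_near. Qed.

Lemma cvg_mulmx m n p (f : T -> 'M[R]_(m, n)) (g : T -> 'M[R]_(n, p))
    (a : 'M[R]_(m, n)) (b : 'M[R]_(n, p)) :
  f x @[x --> F] --> a -> g x @[x --> F] --> b ->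
  f x *m g x @[x --> F] --> a *m b.
Proof.
move=> /cvg_mxP fa /cvg_mxP gb; apply/cvg_mxP => i j; rewrite mxE.
under eq_fun do rewrite mxE.
apply: cvg_big => [|k _]; first exact: add_continuous.
by apply: cvgM; [exact: fa|exact: gb].
Qed.

Lemma cvg_det n (f : T -> 'M[R]_n) (a : 'M[R]_n) :
  f x @[x --> F] --> a -> \det (f x) @[x --> F] --> \det a.
Proof.
move=> /cvg_mxP fa; rewrite /determinant.
apply: cvg_big => [|s _]; first exact: add_continuous.
apply: cvgM; first exact: cvg_cst.
by apply: cvg_big => [|i _]; [exact: mul_continuous|exact: fa].
Qed.

(** Adjugate formula and continuity of determinants. As [invmx] returns its argument on singular
    matrices, the formula is used only where [f x] is invertible. *)
Lemma cvg_invmx n (f : T -> 'M[R]_n) (a : 'M[R]_n) : a \in unitmx ->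
  (\forall x \near F, f x \in unitmx) ->
  f x @[x --> F] --> a -> invmx (f x) @[x --> F] --> invmx a.
Proof.
move=> ua uf fa.
suff : (\det (f x))^-1 *: \adj (f x) @[x --> F] --> invmx a.
  apply: cvg_trans; apply: near_eq_cvg; near=> x.
  by rewrite /invmx (near uf x).
rewrite /invmx ua; apply: cvgZ.
  by apply: cvgV (cvg_det fa); rewrite -unitfE -unitmxE.
apply/cvg_mxP => i j; rewrite mxE; under eq_fun do rewrite mxE.
rewrite /cofactor; apply: cvgM; first exact: cvg_cst.
case: n f a ua uf fa i j => [|n] f a ua uf fa i j; first by case: i.
apply: cvg_det; apply/cvg_mxP => k l; rewrite !mxE.
by under eq_fun do rewrite !mxE; move/cvg_mxP : fa; exact.
Unshelve. all: by end_near. Qed.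

End MatrixLimits.

(** * Oscillation of averages over left translates *)

Section LeftAverages.
Variables (R : realType) (N : nat) (H : set 'M[R]_N).
Hypotheses (H1 : H 1%:M)
  (HM : forall g k, H g -> H k -> H (g *m k))
  (HV : forall g, H g -> H (invmx g))
  (HU : forall g, H g -> g \in unitmx).
Implicit Types (f : 'M[R]_N -> R) (K V : seq 'M[R]_N).

(** [K] is a list, so translates count with multiplicity; composing averages relies on this. *)
Definition lavg K f (y : 'M[R]_N) : R :=
  (size K)%:R^-1 * \sum_(k <- K) f (k *m y).

Definition weights K := K <> [::] /\ forall k, k \in K -> H k.

(** [V] is a finite [e]-net, for the supremum norm on [H], of the right translates of [f]: a form of
    almost periodicity. *)
Definition translate_net V (e : R) f :=
  (forall v, v \in V -> H v) /\
  forall w, H w -> exists2 v, v \in V &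
    forall k, H k -> `|f (k *m v) - f (k *m w)| <= e.

Definition valued_in (m M : R) f := forall y, H y -> m <= f y <= M.

Lemma weights_size K : weights K -> 0 < (size K)%:R :> R.
Proof. by case: K => [[]//|k K _]; rewrite ltr0n. Qed.

Lemma sum_seq_le (I : eqType) (s : seq I) (F : I -> R) c :
  (forall i, i \in s -> F i <= c) -> \sum_(i <- s) F i <= (size s)%:R * c.
Proof.
elim: s => [|i s IH] Fc; first by rewrite big_nil mul0r.
rewrite big_cons /= -nat1r mulrDl mul1r lerD ?Fc ?mem_head//.
by apply: IH => j js; rewrite Fc// inE js orbT.
Qed.

Lemma lavg_le K f y c : weights K -> (forall k, k \in K -> f (k *m y) <= c) ->
  lavg K f y <= c.
Proof.
move=> wK fc; rewrite /lavg mulrC ler_pdivrMr ?weights_size// mulrC.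
exact: sum_seq_le.
Qed.

Lemma lavgN K f y : lavg K (fun y => - f y) y = - lavg K f y.
Proof. by rewrite /lavg sumrN mulrN. Qed.

Lemma lavg_ge K f y c : weights K -> (forall k, k \in K -> c <= f (k *m y)) ->
  c <= lavg K f y.
Proof.
move=> wK fc; rewrite -lerN2 -lavgN; apply: lavg_le => // k kK.
by rewrite lerN2 fc.
Qed.

Lemma lavg_valued_in K m M f : weights K -> valued_in m M f ->
  valued_in m M (lavg K f).
Proof.
move=> wK fv y Hy; apply/andP; split; [apply: lavg_ge|apply: lavg_le] => // k kK;
by have /andP[] := fv _ (HM (wK.2 _ kK) Hy).
Qed.

(** Left averaging commutes with right translation and does not increase the supremum norm, so the
    same net serves for every average of [f]. *)
Lemma lavg_translate_net K V e f : weights K -> translate_net V e f ->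
  translate_net V e (lavg K f).
Proof.
move=> wK [VH fV]; split=> // w /fV[v vV fvw]; exists v => // k Hk.
have -> : lavg K f (k *m v) - lavg K f (k *m w)
    = lavg K (fun l => f (l *m k *m v) - f (l *m k *m w)) 1%:M.
  rewrite /lavg -mulrBr -sumrB; congr (_ * _); apply: eq_bigr => l _.
  by rewrite mulmx1 !mulmxA.
rewrite ler_norml; apply/andP; split; [apply: lavg_ge|apply: lavg_le] => // l lK;
  rewrite mulmx1; have := fvw _ (HM (wK.2 _ lK) Hk); rewrite ler_norml;
  by case/andP.
Qed.

Lemma lavg_comp K L : weights K -> weights L ->
  exists2 J, weights J & forall f, lavg K (lavg L f) = lavg J f.
Proof.
move=> [K0 KH] [L0 LH]; exists [seq l *m k | k <- K, l <- L].
  split; first by case: K K0 {KH} => // k K _; case: L L0 {LH} => // l L.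
  by move=> _ /allpairsP[[k l] /= [kK lL ->]]; apply: HM; [exact: LH|exact: KH].
move=> f; apply/funext => y.
rewrite /lavg size_allpairs big_allpairs_dep natrM invfM -mulrA.
congr (_ * _); rewrite mulr_sumr; apply: eq_bigr => k _; congr (_ * _).
by apply: eq_bigr => l _; rewrite mulmxA.
Qed.

(** Comparing at the identity bounds [f], up to [e], by its values on the finite list [V]. *)
Lemma translate_net_bounded V e f : translate_net V e f ->
  exists B, forall y, H y -> `|f y| <= B.
Proof.
move=> [_ fV]; exists (\sum_(v <- V) `|f v| + e) => y /fV[v vV /(_ _ H1)].
rewrite !mul1mx => fvy.
have fvS : `|f v| <= \sum_(v <- V) `|f v|.
  by rewrite (big_rem v vV)/= lerDl sumr_ge0.
have := ler_normB (f v) (f v - f y); rewrite subKr; lra.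
Qed.

Lemma translate_net_weights V e f : translate_net V e f -> weights V.
Proof.
by move=> [VH fV]; split=> // V0; have [v] := fV _ H1; rewrite V0.
Qed.

(* Translating f so that a net point lands where f is close to its infimum
   lowers the supremum by a fixed amount. *)
Lemma lavg_shrink V e f m M : 0 < e -> translate_net V e f -> valued_in m M f ->
  3 * e <= M - m -> exists K m' M', [/\ weights K, valued_in m' M' (lavg K f) &
    M' - m' <= M - m - e / (size V)%:R].
Proof.
move=> e0 fV fmM mM; have wV := translate_net_weights fV.
have V0 : 0 < (size V)%:R :> R by exact: weights_size.
have V1 : 1 <= (size V)%:R :> R.
  by move: V0; rewrite ltr0n ler1n.
have eV : e / (size V)%:R <= e by rewrite ler_pdivrMr// ler_peMr// ltW.
(* If no value is at most [m + e], the lower bound rises by [e] with the trivial average; otherwise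
   each net point [v] is moved to such an [x] by [x *m invmx v]. *)
have [[x [Hx fx]]|nx] := pselect (exists x, H x /\ f x <= m + e); last first.
  exists [:: 1%:M], (m + e), M; split.
  - by split=> // k; rewrite inE => /eqP ->.
  - move=> y Hy; rewrite /lavg big_seq1 invr1 mul1r mul1mx.
    have /andP[_ ->] := fmM _ Hy; rewrite andbT leNgt; apply/negP => fy.
    by apply: nx; exists y; split=> //; exact: ltW.
  - lra.
pose K := [seq x *m invmx v | v <- V].
have sK : size K = size V by rewrite size_map.
have wK : weights K.
  split; first by move=> K0; move: V0; rewrite -sK K0 ltxx.
  by move=> _ /mapP[v /(wV.2) Hv ->]; apply: HM => //; exact: HV.
exists K, m, (M - e / (size V)%:R); split=> //; last lra.
move=> y Hy; apply/andP; split.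
  by have /andP[] := lavg_valued_in wK fmM Hy.
(* For [v] close to [y], the term of [x *m invmx v] is at most [m + 2 * e <= M - e]; the other terms
   are at most [M], so the mean is at most [M - e / (size V)%:R]. *)
have [v vV fvy] := fV.2 _ Hy; have Hv := wV.2 _ vV.
have {fvy} := fvy _ (HM Hx (HV Hv)).
rewrite mulmxKV ?HU// ler_norml => /andP[fxy _].
rewrite /lavg sK mulrC ler_pdivrMr// mulrBl divfK ?gt_eqF//.
rewrite big_map (big_rem v vV)/=.
have : \sum_(w <- rem v V) f (x *m invmx w *m y) <= (size (rem v V))%:R * M.
  apply: sum_seq_le => w /mem_rem /(wV.2) Hw.
  by have /andP[] := fmM _ (HM (HM Hx (HV Hw)) Hy).
have -> : (size V)%:R = 1 + (size (rem v V))%:R :> R.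
  by rewrite size_rem// nat1r prednK//; move: V0; rewrite ltr0n.
rewrite mulrDr mulr1 [(size _)%:R * M]mulrC; lra.
Qed.

(** Shrinking is repeated until the oscillation is at most [3 * e]. The net survives averaging, so
    every round gains the same amount [d] and finitely many rounds suffice. *)
Lemma lavg_small_osc V e f : 0 < e -> translate_net V e f ->
  exists K m M, [/\ weights K, valued_in m M (lavg K f) & M - m <= 3 * e].
Proof.
move=> e0 fV; have [B fB] := translate_net_bounded fV.
have V0 : 0 < (size V)%:R :> R by apply: weights_size; exact: translate_net_weights fV.
pose d := e / (size V)%:R; have d0 : 0 < d by rewrite divr_gt0.
suff osc n : forall g m M, translate_net V e g -> valued_in m M g ->
    M - m <= 3 * e + n%:R * d ->
    exists K m M, [/\ weights K, valued_in m M (lavg K g) & M - m <= 3 * e].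
  have := archi_boundP (ltW (divr_gt0 (ltr_pwDr ltr01 (normr_ge0 (B - - B))) d0)).
  set n := Num.bound _ => nB.
  apply: (osc n f (- B) B) => //; first by move=> y /fB; rewrite ler_norml.
  have : `|B - - B| + 1 < n%:R * d by rewrite -ltr_pdivrMr.
  have := ler_norm (B - - B); lra.
elim: n => [|n IH] g m M gV gmM mM.
  exists [:: 1%:M], m, M; split.
  - by split=> // k; rewrite inE => /eqP ->.
  - by move=> y Hy; rewrite /lavg big_seq1 invr1 mul1r mul1mx; exact: gmM.
  - by move: mM; rewrite mul0r addr0.
have [small|big] := leP (M - m) (3 * e).
  by apply: (IH g m M) => //; rewrite (le_trans small)// lerDl mulr_ge0// ltW.
have [K [m' [M' [wK Kg mM']]]] := lavg_shrink e0 gV gmM (ltW big).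
have [||L [m2 [M2 [wL Lg mM2]]]] := IH (lavg K g) m' M' _ Kg.
- exact: lavg_translate_net.
- by move: mM mM'; rewrite -/d -natr1 mulrDl mul1r; lra.
have [J wJ LK] := lavg_comp wL wK.
by exists J, m2, M2; rewrite -LK.
Qed.

(** A common [K] is built one function at a time: averaging again keeps the value bounds already
    obtained for the earlier functions. *)
Lemma lavg_small_osc_fam (I : eqType) (s : seq I) (e : R)
    (D : I -> 'M[R]_N -> R) : 0 < e ->
  (forall i, exists V, translate_net V e (D i)) ->
  exists2 K, weights K & forall i, i \in s -> exists m M,
    valued_in m M (lavg K (D i)) /\ M - m <= 3 * e.
Proof.
move=> e0 netD; elim: s => [|i s [K wK IH]].
  by exists [:: 1%:M] => //; split=> // k; rewrite inE => /eqP ->.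
have [V DV] := netD i.
have [L [m [M [wL Li mM]]]] := lavg_small_osc e0 (lavg_translate_net wK DV).
have [J wJ LK] := lavg_comp wL wK.
exists J => // j; rewrite inE => /predU1P[->|/IH[mj [Mj [Dj mMj]]]].
  by exists m, M; rewrite -LK.
by exists mj, Mj; rewrite -LK; split=> //; exact: lavg_valued_in.
Qed.

End LeftAverages.

(** * Derivatives of bounded functions and constant divergences *)

Lemma is_derive_sum_seq (R : realType) (V W : normedModType R) (I : eqType)
    (s : seq I) (f : I -> V -> W) (df : I -> W) (x v : V) :
  (forall i, i \in s -> is_derive x v (f i) (df i)) ->
  is_derive x v (fun y => \sum_(i <- s) f i y) (\sum_(i <- s) df i).
Proof.
elim: s => [|i s IH] fs.
  rewrite big_nil; under eq_fun do rewrite big_nil; exact: is_derive_cst.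
rewrite big_cons; under eq_fun do rewrite big_cons.
apply: is_deriveD; first by apply: fs; rewrite mem_head.
by apply: IH => j js; apply: fs; rewrite inE js orbT.
Qed.

Lemma bounded_derive_small (R : realType) (f df : R -> R) (B a : R) :
  (forall s : R, is_derive s (1 : R) f (df s)) -> (forall s, `|f s| <= B) ->
  (forall s, a <= df s) -> a <= 0.
Proof.
move=> fdf fB adf; rewrite leNgt; apply/negP => a0.
have B0 : 0 <= B by exact: le_trans (normr_ge0 _) (fB 0).
(* Over this length, a derivative at least [a] forces an increase of [B + B + 1], more than a
   function bounded by [B] allows. *)
pose T := (B + B + 1) / a; have T0 : 0 < T by rewrite divr_gt0//; lra.
have cf : {within `[0, T], continuous f}.
  apply: derivable_within_continuous => x _.
  exact: (@ex_derive _ _ _ _ _ _ _ (fdf x)).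
have [c _] := MVT T0 (fun x _ => fdf x) cf.
rewrite subr0 => E.
have : a * T <= f T - f 0 by rewrite E ler_wpM2r// ltW.
rewrite /T mulrC divfK ?gt_eqF//.
move: (fB T) (fB 0); rewrite !ler_norml => /andP[? ?] /andP[? ?]; lra.
Qed.

(** Left translation commutes with right multiplication by [fl j s], so an average of [D j] is still
    the derivative of a bounded function. Once almost constant it is almost 0, while the averages at
    the identity still sum to [c]. *)
Lemma constant_divergence_eq0 (R : realType) (N r : nat) (H : set 'M[R]_N)
    (H1 : H 1%:M) (HM : forall g k, H g -> H k -> H (g *m k))
    (HV : forall g, H g -> H (invmx g)) (HU : forall g, H g -> g \in unitmx)
    (fl : 'I_r -> R -> 'M[R]_N) (D Q : 'I_r -> 'M[R]_N -> R) (c : R) :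
  (forall j s, H (fl j s)) ->
  (forall j k (s : R), H k ->
    is_derive s (1 : R) (fun s => Q j (k *m fl j s)) (D j (k *m fl j s))) ->
  (forall j, exists B : R, forall k, H k -> `|Q j k| <= B) ->
  (forall j (e : R), 0 < e -> exists V, translate_net H V e (D j)) ->
  (forall k, H k -> \sum_j D j k = c) -> c = 0.
Proof.
move=> Hfl QD Qb Dnet Dc; apply/eqP; rewrite -normr_eq0; apply/eqP/le_anti.
rewrite normr_ge0 andbT; apply/ler_addgt0Pl => e e0; rewrite addr0.
(* Each of the [r] terms will be at most [3 * e']; [r.+1] keeps the denominator positive when [r] is
   0. *)
pose e' := e / (4 * r.+1%:R); have e'0 : 0 < e' by rewrite divr_gt0// mulr_gt0.
have [K wK DK] := lavg_small_osc_fam H1 HM HV HU (enum 'I_r) e'0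
  (fun j => Dnet j _ e'0).
have DK1 : c = \sum_j lavg K (D j) 1%:M.
  rewrite /lavg -mulr_sumr exchange_big/=.
  rewrite (eq_big_seq (fun=> c)) => [|k kK]; last first.
    by under eq_bigr do rewrite mulmx1; rewrite Dc//; exact: wK.2.
  rewrite big_const_seq count_predT iter_addr_0 -[c *+ _]mulr_natl mulKf//.
  by rewrite gt_eqF// (weights_size wK).
have small j : `|lavg K (D j) 1%:M| <= 3 * e'.
  have [|m [M [DmM mM]]] := DK j; first by rewrite mem_enum.
  have [B QB] := Qb j.
  have QK s : is_derive s (1 : R) (fun s => lavg K (Q j) (fl j s)) (lavg K (D j) (fl j s)).
    apply: (@is_deriveZ _ _ _ (fun s => \sum_(k <- K) Q j (k *m fl j s))).
    by apply: is_derive_sum_seq => k kK; apply: QD; exact: wK.2.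
  have QKB s : `|lavg K (Q j) (fl j s)| <= B.
    rewrite ler_norml; apply/(lavg_valued_in HM wK) => // y /QB.
    by rewrite ler_norml.
  (* A positive lower bound or a negative upper bound would make the bounded average of [Q j] grow
     or decrease linearly along the flow; hence 0 lies between [m] and [M]. *)
  have m0 : m <= 0.
    apply: (bounded_derive_small QK QKB) => s.
    by have /andP[] := DmM _ (Hfl j s).
  have M0 : 0 <= M.
    rewrite -oppr_le0; apply: (@bounded_derive_small _
      (fun s => - lavg K (Q j) (fl j s)) (fun s => - lavg K (D j) (fl j s)) B).
    - by move=> s; rewrite normrN.
    - by move=> s; rewrite lerN2; have /andP[] := DmM _ (Hfl j s).
  have /andP[? ?] := DmM _ H1; rewrite ler_norml; apply/andP; split; lra.
rewrite DK1 (le_trans (ler_norm_sum _ _ _))//.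
have : \sum_j `|lavg K (D j) 1%:M| <= \sum_(j < r) 3 * e' by exact: ler_sum.
move=> /le_trans; apply; rewrite sumr_const card_ord -mulr_natl.
have -> : e = 4 * r.+1%:R * e' by rewrite mulrC divfK// gt_eqF// mulr_gt0.
rewrite -nat1r; have : 0 <= r%:R * e' by rewrite mulr_ge0// ltW.
lra.
Qed.

(** Compactness is used twice: to make the dependence on the right factor uniform in the left
    factor, and to extract a finite net. Uniformity over all of [G] lets a single [V] serve every
    [g]. *)
Lemma compact_translate_net (R : realType) (N : nat) (G H : set 'M[R]_N)
    (f : 'M[R]_N -> R) (e : R) :
  compact G -> H `<=` G -> (forall g k, G g -> G k -> G (g *m k)) ->
  {within G, continuous f} -> 0 < e ->
  exists V, forall g, G g -> translate_net H V e (fun k => f (g *m k)).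
Proof.
move=> cG HG GM fc e0.
have near_w w : G w -> \forall w' \near w, G w' -> forall k, G k ->
    `|f (k *m w) - f (k *m w')| < e / 2.
  move=> Gw.
  have /near_covering_withinP := (compact_near_coveringP G).1 cG.
  move=> /(_ _ (within G (nbhs w))
    (fun w' k => `|f (k *m w) - f (k *m w')| < e / 2) _) cov.
  suff : \forall w' \near within G (nbhs w), G `<=`
      (fun k => `|f (k *m w) - f (k *m w')| < e / 2).
    by [].
  apply: cov => k Gk.
  have /cvgrPdist_lt/(_ (e / 4)) : f @ within G (nbhs (k *m w)) --> f (k *m w).
    by move/subspace_continuousP : fc; apply; exact: GM.
  rewrite divr_gt0// => /(_ isT) fnear.
  have : p.1 *m p.2 @[p --> (k, w)] --> k *m w.
    by apply: cvg_mulmx; [exact: cvg_fst|exact: cvg_snd].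
  move=> /(_ _ fnear)[[U W] /= [Uk Ww] UW].
  near=> k' w' => Gk'.
  have Gw' : G w' by near: w'; exact: withinT.
  have fk'w : `|f (k *m w) - f (k' *m w)| < e / 4.
    apply: (UW (k', w)); last exact: GM.
    by split=> /=; [near: k'|exact: nbhs_singleton].
  have fk'w' : `|f (k *m w) - f (k' *m w')| < e / 4.
    apply: (UW (k', w')); last exact: GM.
    by split=> /=; [near: k'|near: w'; exact: cvg_within].
  have := ler_distD (f (k *m w)) (f (k' *m w)) (f (k' *m w')).
  rewrite [`|f (k' *m w) - f (k *m w)|]distrC; lra.
(* The filter generated by the lists containing a prescribed finite list: a property eventually true
   for it holds once enough net points are present. *)
pose S := filter_from [set: seq 'M[R]_N] (fun V0 => [set V : seq 'M[R]_N | {subset V0 <= V}]).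
have FS : Filter S.
  apply: filter_from_filter; first by exists [::].
  move=> V0 V1 _ _; exists (V0 ++ V1) => // V sV; split=> v vV; apply: sV;
    by rewrite mem_cat vV ?orbT.
pose isnet (V : seq 'M[R]_N) w := H w -> exists2 v, v \in V &
  H v /\ forall k, G k -> `|f (k *m v) - f (k *m w)| <= e.
have isnet_near w : G w -> \forall w' \near w & V \near S, isnet V w'.
  move=> /near_w wnear.
  (* Net points must lie in [H], which is not assumed closed. Either some [h] in [H] has its
     translate within [e / 2] of that of [w], or no point of [H] is near [w] and the condition is
     void there. *)
  have [[h [Hh hw]]|nh] := pselect (exists h, H h /\ forall k, G k ->
      `|f (k *m w) - f (k *m h)| < e / 2).
    near=> w' V; have hV : h \in V.
      by near: V; exists [:: h] => // V; apply; rewrite inE.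
    move=> Hw'; exists h => //.
    split=> // k Gk; have := hw k Gk.
    have : `|f (k *m w) - f (k *m w')| < e / 2.
      by apply: (near wnear w') => //; exact: HG.
    have := ler_distD (f (k *m w)) (f (k *m h)) (f (k *m w')).
    rewrite [`|f (k *m h) - f (k *m w)|]distrC; lra.
  near=> w' V => Hw'; exfalso; apply: nh; exists w'; split=> //.
  by apply: (near wnear w') => //; exact: HG.
have [V0 _ /(_ V0 (fun=> id)) GV0] :=
  (compact_near_coveringP G).1 cG _ S isnet FS isnet_near.
 exists [seq v <- V0 | `[< H v >]] => g Gg; split.
  by move=> v; rewrite mem_filter => /andP[/asboolP].
move=> w Hw; have [|v vV [Hv fv]] := GV0 w _ Hw; first exact: HG.
exists v; [rewrite mem_filter vV andbT; exact/asboolP|move=> k /HG Gk].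
by rewrite !mulmxA fv//; exact: GM.
Unshelve. all: by end_near. Qed.

(** * The matrix exponential *)

Section ExponentialBound.
Variables (R : realType) (b : R).
Hypothesis b0 : 0 <= b.

(** This growth class is stable under formal differentiation and gives convergence everywhere, so
    termwise differentiation is valid at every point. *)
Definition exp_bounded (c : R^nat) :=
  exists2 K, 0 <= K & forall k, `|c k| <= K * b ^+ k / k`!%:R.

Lemma cvg_pseries_exp_bounded c x : exp_bounded c -> cvgn (pseries c x).
Proof.
move=> [K K0 cK]; apply: normed_cvg.
apply: (@series_le_cvg _ _ (K *: exp_coeff (b * `|x|))) => //.
- by move=> k; exact: normr_ge0.
- move=> k; change (0 <= K * exp_coeff (b * `|x|) k).
  by rewrite mulr_ge0// exp_coeff_ge0// mulr_ge0.
- move=> k; change (`|c k * x ^+ k| <= K * exp_coeff (b * `|x|) k).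
  rewrite normrM normrX /exp_coeff/= exprMn.
  rewrite [leRHS](_ : _ = K * b ^+ k / k`!%:R * `|x| ^+ k); last by ring.
  by rewrite ler_wpM2r// exprn_ge0.
- by apply: is_cvg_seriesZ; exact: is_cvg_series_exp_coeff.
Qed.

Lemma exp_bounded_diffs c : exp_bounded c -> exp_bounded (pseries_diffs c).
Proof.
move=> [K K0 cK]; exists (K * b) => [|k]; first exact: mulr_ge0.
rewrite /pseries_diffs normrM normr_nat.
rewrite (le_trans (ler_wpM2l _ (cK k.+1)))// factS natrM invfM exprS.
rewrite le_eqVlt; apply/orP; left; apply/eqP; field.
by rewrite nat1r !pnatr_eq0 -lt0n fact_gt0.
Qed.

Lemma is_derive_pseries_exp_bounded c (x : R) : exp_bounded c ->
  is_derive x (1 : R) (fun x => limn (pseries c x))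
    (limn (pseries (pseries_diffs c) x)).
Proof.
move=> cK; apply: (@pseries_snd_diffs _ c (`|x| + 1)).
- exact: cvg_pseries_exp_bounded.
- by apply: cvg_pseries_exp_bounded; exact: exp_bounded_diffs.
- by apply: cvg_pseries_exp_bounded; do 2! apply: exp_bounded_diffs.
- by rewrite [ltRHS]ger0_norm ?addr_ge0// ltrDl ltr01.
Qed.

End ExponentialBound.

(** * Entrywise series, differentiation and one-parameter group law *)

Section MatrixExponential.
Variables (R : realType) (N : nat).
Implicit Types X Y : 'M[R]_N.

Lemma mx_norm_coord m n (A : 'M[R]_(m, n)) i j : `|A i j| <= `|A|.
Proof. by rewrite [leRHS]/Num.Def.normr/= mx_normrE (le_bigmax _ _ (i, j)). Qed.

(** The norm is the largest absolute value of an entry, which is not submultiplicative; the factor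
    [N] accounts for the sum in each product. *)
Lemma expmx_coord_le X k i j : `|(X ^+ k) i j| <= (N%:R * `|X|) ^+ k.
Proof.
elim: k i j => [|k IH] i j.
  by rewrite !expr0 mxE; case: (_ == _); rewrite ?normr1 ?normr0.
rewrite exprS mxE (le_trans (ler_norm_sum _ _ _))//.
have : \sum_l `|X i l * (X ^+ k) l j| <= \sum_(l < N) `|X| * (N%:R * `|X|) ^+ k.
  by apply: ler_sum => l _; rewrite normrM ler_pM// mx_norm_coord.
move=> /le_trans; apply; rewrite sumr_const card_ord -[_ *+ N]mulr_natl mulrA.
by rewrite exprS.
Qed.

Definition mexp_coef X i j : R^nat := fun k => (k`!%:R)^-1 * (X ^+ k) i j.

Lemma mexp_coef_bounded X i j : exp_bounded (N%:R * `|X|) (mexp_coef X i j).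
Proof.
exists 1 => // k; rewrite /mexp_coef normrM mul1r mulrC normfV normr_nat.
by rewrite ler_wpM2r//; exact: expmx_coord_le.
Qed.

Lemma expmxZ (s : R) X k : (s *: X) ^+ k = s ^+ k *: X ^+ k.
Proof.
elim: k => [|k IH]; first by rewrite !expr0 scale1r.
by rewrite !exprS IH -!mulmxE -scalemxAl -scalemxAr scalerA.
Qed.

Lemma cvg_mexp_series (s : R) X :
  series (fun k => (k`!%:R)^-1 *: (s *: X) ^+ k) @ \oo -->
    \matrix_(i, j) limn (pseries (mexp_coef X i j) s).
Proof.
apply/cvg_mxP => k l; rewrite mxE.
rewrite (_ : (fun n => _) = pseries (mexp_coef X k l) s).
  apply: cvg_pseries_exp_bounded (mexp_coef_bounded X k l).
  by rewrite mulr_ge0.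
apply/funext => n; rewrite /pseries /series/= summxE.
by apply: eq_bigr => m _; rewrite expmxZ !mxE /mexp_coef; ring.
Qed.

Lemma mexp_coord X s i j :
  mexp (s *: X) i j = limn (pseries (mexp_coef X i j) s).
Proof. by rewrite /mexp (cvg_lim _ (@cvg_mexp_series s X))// mxE. Qed.

Lemma cvg_mexp (s : R) X :
  series (fun k => (k`!%:R)^-1 *: (s *: X) ^+ k) @ \oo --> mexp (s *: X).
Proof. by have := @cvg_mexp_series s X; rewrite -(cvg_lim _ (@cvg_mexp_series s X)). Qed.

Lemma mexp_conj g X : g \in unitmx ->
  mexp (g *m X *m invmx g) = g *m mexp X *m invmx g.
Proof.
move=> ug; apply: cvg_lim => //.
have := @cvg_mexp 1 X; rewrite scale1r => eX.
rewrite (_ : series _ = fun n =>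
    g *m series (fun k => (k`!%:R)^-1 *: X ^+ k) n *m invmx g).
  exact: (cvg_mulmx (cvg_mulmx (cvg_cst g) eX) (cvg_cst (invmx g))).
apply/funext => n.
rewrite /series/= mulmx_sumr mulmx_suml; apply: eq_bigr => k _.
rewrite -scalemxAr -scalemxAl; congr (_ *: _).
elim: k => [|k IH]; first by rewrite !expr0 mulmx1 mulmxV.
by rewrite !exprS -!mulmxE IH !mulmxA mulmxKV.
Qed.

(** Taken entrywise, so that the product rule reduces to the scalar one. *)
Definition is_mderive m n (A : R -> 'M[R]_(m, n)) (s : R) (A' : 'M[R]_(m, n)) :=
  forall i j, is_derive s (1 : R) (fun s => A s i j) (A' i j).

Lemma is_mderiveP m n (A : R -> 'M[R]_(m, n)) (s : R) (A' : 'M[R]_(m, n)) :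
  is_mderive A s A' <-> is_derive s (1 : R) A A'.
Proof.
split=> [AA'|AA' i j].
  have dA : derivable A s 1.
    by apply/derivable_mxP => i j; exact: (@ex_derive _ _ _ _ _ _ _ (AA' i j)).
  apply: DeriveDef => //; rewrite derive_mx//; apply/matrixP => i j.
  by rewrite mxE; exact: (@derive_val _ _ _ _ _ _ _ (AA' i j)).
have dA : derivable A s 1 by exact: (@ex_derive _ _ _ _ _ _ _ AA').
apply: DeriveDef; first exact: (derivable_mxP _ _ _).1.
by rewrite -(@derive_val _ _ _ _ _ _ _ AA') derive_mx// mxE.
Qed.

Lemma is_mderive_mulmx m n p (A : R -> 'M[R]_(m, n)) (B : R -> 'M[R]_(n, p))
    (s : R) (A' : 'M[R]_(m, n)) (B' : 'M[R]_(n, p)) :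
  is_mderive A s A' -> is_mderive B s B' ->
  is_mderive (fun s => A s *m B s) s (A' *m B s + A s *m B').
Proof.
move=> AA' BB' i j; under eq_fun do rewrite mxE; rewrite !mxE -big_split/=.
apply: is_derive_sum_seq => k _.
have dM := is_deriveM (AA' i k) (BB' k j); apply: is_derive_eq.
by rewrite addrC /GRing.scale/= [B s k j * _]mulrC.
Qed.

Lemma is_mderive_cst m n (A : 'M[R]_(m, n)) (s : R) : is_mderive (fun=> A) s 0.
Proof. by move=> i j; rewrite mxE; exact: is_derive_cst. Qed.

Lemma is_mderive_mulmxl m n p (A : 'M[R]_(m, n)) (B : R -> 'M[R]_(n, p))
    (s : R) (B' : 'M[R]_(n, p)) :
  is_mderive B s B' -> is_mderive (fun s => A *m B s) s (A *m B').
Proof.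
by move=> /(is_mderive_mulmx (is_mderive_cst A s)); rewrite mul0mx add0r.
Qed.

Lemma is_mderive_mulmxr m n p (A : R -> 'M[R]_(m, n)) (B : 'M[R]_(n, p))
    (s : R) (A' : 'M[R]_(m, n)) :
  is_mderive A s A' -> is_mderive (fun s => A s *m B) s (A' *m B).
Proof.
by move=> AA'; have := is_mderive_mulmx AA' (is_mderive_cst B s); rewrite mulmx0 addr0.
Qed.

Lemma is_mderive0_cst m n (A : R -> 'M[R]_(m, n)) :
  (forall s, is_mderive A s 0) -> forall s t, A s = A t.
Proof.
move=> A0 s t; apply/matrixP => i j.
by apply: (@is_derive_0_is_cst _ (fun s => A s i j)) => x; have := A0 x i j; rewrite mxE.
Qed.

Lemma mexp0 : mexp 0 = 1%:M :> 'M[R]_N.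
Proof.
rewrite /mexp; apply: lim_near_cst => //; near=> k.
have k0 : (0 < k)%N by near: k; exists 1%N.
rewrite /series/= -(prednK k0) big_nat_recl//= invr1 scale1r expr0 big1 ?addr0//.
by move=> i _; rewrite expr0n scaler0.
Unshelve. all: by end_near. Qed.

Lemma is_mderive_mexp X (s : R) :
  is_mderive (fun s => mexp (s *: X)) s (X *m mexp (s *: X)).
Proof.
move=> i j; have X0 : 0 <= N%:R * `|X| by rewrite mulr_ge0.
have -> : (X *m mexp (s *: X)) i j
    = limn (pseries (pseries_diffs (mexp_coef X i j)) s).
  apply/esym/cvg_lim => //; rewrite mxE.
  rewrite (_ : pseries _ s = fun n => \sum_l X i l * pseries (mexp_coef X l j) s n).
    apply: cvg_big => [|l _]; first exact: add_continuous.
    apply: cvgM; first exact: cvg_cst.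
    rewrite mexp_coord; exact: cvg_pseries_exp_bounded (mexp_coef_bounded X l j).
  apply/funext => n; rewrite /pseries /series/=.
  under [RHS]eq_bigr do rewrite mulr_sumr.
  rewrite exchange_big/=; apply: eq_bigr => k _.
  rewrite /pseries_diffs /mexp_coef exprS mxE !mulr_sumr mulr_suml.
  apply: eq_bigr => l _; rewrite factS natrM; field.
  by rewrite nat1r !pnatr_eq0 -lt0n fact_gt0.
under eq_fun do rewrite mexp_coord.
exact: is_derive_pseries_exp_bounded X0 _ _ (mexp_coef_bounded X i j).
Qed.

Lemma mexp_comm X (s : R) : X *m mexp (s *: X) = mexp (s *: X) *m X.
Proof.
have XeX := cvg_mulmx (cvg_cst X) (@cvg_mexp s X).
rewrite -(cvg_lim _ (XeX _ _))//; apply: cvg_lim => //.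
rewrite (_ : (fun n => _) = fun n =>
  series (fun k => (k`!%:R)^-1 *: (s *: X) ^+ k) n *m X).
  by apply: cvg_mulmx; [exact: cvg_mexp|exact: cvg_cst].
apply/funext => n; rewrite /series/= mulmx_sumr mulmx_suml; apply: eq_bigr => k _.
rewrite -scalemxAr -scalemxAl expmxZ -scalemxAr -scalemxAl.
by congr (_ *: (_ *: _)); rewrite !mulmxE -exprS -exprSr.
Qed.

Lemma is_mderive_mexpN X (s : R) :
  is_mderive (fun s => mexp (- s *: X)) s (- (X *m mexp (- s *: X))).
Proof.
move=> i j; rewrite mxE.
have := @is_derive1_comp _ (fun s => mexp (s *: X) i j) -%R s _ _
  (is_mderive_mexp X (- s) i j) (is_deriveNid s 1).
by move=> /is_derive_eq; apply; rewrite /GRing.scale/= mulrN1.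
Qed.

Lemma mexpNK X (s : R) : mexp (s *: X) *m mexp (- s *: X) = 1%:M.
Proof.
have cst t : is_mderive (fun t => mexp (t *: X) *m mexp (- t *: X)) t 0.
  have := is_mderive_mulmx (is_mderive_mexp X t) (is_mderive_mexpN X t).
  by rewrite mexp_comm mulmxN mulmxA subrr.
by rewrite (is_mderive0_cst cst s 0) oppr0 scale0r mexp0 mulmx1.
Qed.

Lemma mexpD X (s t : R) : mexp ((s + t) *: X) = mexp (s *: X) *m mexp (t *: X).
Proof.
(* The derivative in [u] vanishes because [X] commutes with its exponential; the values at [u = s]
   and [u = 0] are then compared. *)
have cst u : is_mderive (fun u => mexp (- u *: X) *m mexp ((u + t) *: X)) u 0.
  have dt : is_mderive (fun u => mexp ((u + t) *: X)) u (X *m mexp ((u + t) *: X)).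
    move=> i j.
    have := @is_derive1_comp _ (fun u => mexp (u *: X) i j) (fun u => u + t) u _ _
      (is_mderive_mexp X (u + t) i j) (is_derive_shift u 1 t).
    by move=> /is_derive_eq; apply; rewrite /GRing.scale/= mulr1.
  have := is_mderive_mulmx (is_mderive_mexpN X u) dt.
  by rewrite mulNmx mulmxA -mexp_comm addNr.
have := is_mderive0_cst cst s 0; rewrite oppr0 scale0r mexp0 mul1mx add0r.
by move=> <-; rewrite mulmxA mexpNK mul1mx.
Qed.

Lemma mexpN X (s : R) : mexp (- s *: X) = invmx (mexp (s *: X)).
Proof.
have e1 := mexpNK X s; have [us _] := mulmx1_unit e1.
by rewrite -[RHS]mulmx1 -e1 mulKmx.
Qed.

End MatrixExponential.

(** * Calculus with matrices and the invariant metric *)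

Lemma linear_mx_continuous (R : realType) m n (W : normedModType R)
  (L : {linear 'M[R]_(m, n) -> W}) : continuous L.
Proof.
have -> : (L : _ -> _) = fun A => \sum_i \sum_j A i j *: L (delta_mx i j).
  apply/funext => B; rewrite {1}(matrix_sum_delta B) linear_sum.
  apply: eq_bigr => i _; rewrite linear_sum; apply: eq_bigr => j _.
  by rewrite linearZ.
move=> A; apply: cvg_big => [||i _]; [exact: add_continuous|exact: nbhs_filter|].
apply: cvg_big => [||j _]; [exact: add_continuous|exact: nbhs_filter|].
by apply: cvgZr_tmp; [exact: nbhs_filter|exact: coord_continuous].
Qed.

Lemma is_derive_linear (R : realType) (U V W : normedModType R)
    (L : {linear V -> W}) (f : U -> V) (x v : U) (df : V) :
  continuous L -> is_derive x v f df -> is_derive x v (L \o f) (L df).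
Proof.
move=> cL fdf.
have fD : derivable f x v by exact: (@ex_derive _ _ _ _ _ _ _ fdf).
have E := @derive_val _ _ _ _ _ _ _ fdf.
have Lf : h^-1 *: ((L \o f) (h *: v + x) - (L \o f) x) @[h --> 0^'] --> L df.
  rewrite -E (_ : (fun h => _) = L \o (fun h => h^-1 *: (f (h *: v + x) - f x))).
    have fl : h^-1 *: (f (h *: v + x) - f x) @[h --> 0^'] --> 'D_v f x by exact: fD.
    exact: (cvg_comp _ _ fl (cL _)).
  by apply/funext => t; rewrite /= linearZ [L (_ - _)]linearB.
by split; [apply/cvg_ex; exists (L df)|exact: cvg_lim Lf].
Qed.

Lemma is_derive_pair (R : realType) (U V : normedModType R)
    (f : R -> U) (g : R -> V) (s : R) (df : U) (dg : V) :
  is_derive s (1 : R) f df -> is_derive s (1 : R) g dg ->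
  is_derive s (1 : R) (fun s => (f s, g s)) (df, dg).
Proof.
move=> fdf gdg.
have df' : differentiable f s.
  by apply/derivable1_diffP; exact: (@ex_derive _ _ _ _ _ _ _ fdf).
have dg' : differentiable g s.
  by apply/derivable1_diffP; exact: (@ex_derive _ _ _ _ _ _ _ gdg).
apply: DeriveDef; first by apply/diff_derivable/differentiable_pair.
rewrite deriveE; last exact: differentiable_pair.
by rewrite diff_pair// -!deriveE// !derive_val.
Qed.

Lemma is_derive_comp_curve (R : realType) (U W : normedModType R)
    (c : R -> U) (g : U -> W) (s : R) (c' : U) :
  is_derive s (1 : R) c c' -> differentiable g (c s) ->
  is_derive s (1 : R) (g \o c) ('D_c' g (c s)).
Proof.
move=> cc' gd.
have cd : differentiable c s.
  by apply/derivable1_diffP; exact: (@ex_derive _ _ _ _ _ _ _ cc').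
apply: DeriveDef; first by apply/diff_derivable/differentiable_comp.
rewrite deriveE; last exact: differentiable_comp.
by rewrite diff_comp//= [RHS]deriveE// -(@derive_val _ _ _ _ _ _ _ cc') deriveE.
Qed.

Lemma is_derive_from0 (R : realType) (W : normedModType R) (f : R -> W) (s : R)
    (df : W) :
  is_derive (0 : R) (1 : R) (fun t => f (s + t)) df -> is_derive s (1 : R) f df.
Proof.
have E : (fun h : R => h^-1 *: (f (h *: 1 + s) - f s)) =
    (fun h : R => h^-1 *: (f (s + (h *: 1 + 0)) - f (s + 0))).
  by apply/funext => h; rewrite !addr0 [s + _]addrC.
by case=> D1 D2; apply: DeriveDef; [rewrite /derivable E|rewrite /derive E].
Qed.

(** * The Lie algebra and its invariant metric *)

Section Algebra.
Variables (R : realType) (N r : nat) (G : matrix_lie_group R N r).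

Lemma lgrp_mexp X (s : R) : X \in lalg G -> lgrp G (mexp (s *: X)).
Proof. by move=> /(lieE G). Qed.

Lemma tb_lalg j : tb G j \in lalg G.
Proof. by apply: (basis_mem (tbasisP G)); exact: mem_tnth. Qed.

Lemma lalg_conj g X : lgrp G g -> X \in lalg G -> g *m X *m invmx g \in lalg G.
Proof.
move=> Gg GX; apply/(lieE G) => s.
have -> : s *: (g *m X *m invmx g) = g *m (s *: X) *m invmx g.
  by rewrite -scalemxAr -scalemxAl.
rewrite mexp_conj; last exact: grp_unit Gg.
by apply: grpM; [apply: grpM => //; exact: lgrp_mexp|exact: grpV].
Qed.

Lemma is_mderive_conj (X Y : 'M[R]_N) :
  is_mderive (fun s => mexp (s *: X) *m Y *m mexp (- s *: X)) 0 (brk X Y).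
Proof.
have := is_mderive_mulmx (is_mderive_mulmxr Y (is_mderive_mexp X 0))
  (is_mderive_mexpN X 0).
by rewrite oppr0 scale0r mexp0 !mulmx1 mul1mx mulmxN.
Qed.

(** The bracket is the derivative at 0 of a curve of conjugates of [Y] that stays in the Lie
    algebra. The projection [L] fixes this curve and, being linear and continuous, also its
    derivative. *)
Lemma brk_lalg X Y : X \in lalg G -> Y \in lalg G -> brk X Y \in lalg G.
Proof.
move=> GX GY; pose L : {linear 'M[R]_N -> 'M[R]_N} := projv (lalg G).
have /is_mderiveP D := is_mderive_conj X Y.
have cL : continuous L by exact: linear_mx_continuous.
have /is_mderiveP LD := is_derive_linear cL D.
suff -> : brk X Y = L (brk X Y) by exact: memv_proj.
have E : L \o (fun s : R => mexp (s *: X) *m Y *m mexp (- s *: X)) =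
    (fun s : R => mexp (s *: X) *m Y *m mexp (- s *: X)).
  apply/funext => s /=; apply: projv_id; rewrite mexpN.
  by apply: lalg_conj => //; exact: lgrp_mexp.
apply/matrixP => i j.
have /(_ i j) LDij := LD; have /is_mderiveP/(_ i j) Dij := D.
rewrite -(@derive_val _ _ _ _ _ _ _ Dij) -(@derive_val _ _ _ _ _ _ _ LDij).
by rewrite -/(L \o _) E.
Qed.

Lemma lcoordE X : X \in lalg G -> X = \sum_i lcoord G X 0 i *: tb G i.
Proof.
move=> GX; rewrite {1}(coord_basis (tbasisP G) GX); apply: eq_bigr => i _.
by rewrite mxE /tb (tnth_nth 0).
Qed.

Lemma lcoord_sum (c : 'rV[R]_r) : lcoord G (\sum_i c 0 i *: tb G i) = c.
Proof.
apply/rowP => j; rewrite mxE.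
under eq_bigr do rewrite /tb (tnth_nth 0).
by rewrite coord_sum_free//; exact: basis_free (tbasisP G).
Qed.

Lemma lcoord_is_linear : linear (lcoord G).
Proof. by move=> c X Y; apply/rowP => i; rewrite !mxE linearP. Qed.

HB.instance Definition _ := GRing.isLinear.Build _ _ _ _ (lcoord G) lcoord_is_linear.

Variables (h : 'M[R]_r) (h_metric : Ad_invariant_metric G h).

Lemma h_sharp_is_linear : linear (h_sharp G h).
Proof.
move=> c l l'; rewrite /h_sharp scaler_sumr -big_split/=; apply: eq_bigr => i _.
by rewrite mulmxDl -scalemxAl !mxE scalerDl scalerA.
Qed.

HB.instance Definition _ :=
  GRing.isLinear.Build _ _ _ _ (h_sharp G h) h_sharp_is_linear.

Lemma h_sharp_lalg l : h_sharp G h l \in lalg G.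
Proof. by apply: rpred_sum => i _; apply: rpredZ; exact: tb_lalg. Qed.

Lemma hformE X Y : hform G h X Y = (lcoord G X *m h *m (lcoord G Y)^T) 0 0.
Proof.
rewrite /hform exchange_big/= mxE; apply: eq_bigr => j _.
rewrite !mxE mulr_suml; apply: eq_bigr => i _; rewrite !mxE; ring.
Qed.

(** Ad-invariance of the metric, differentiated at 0 along [mexp (s *: Z)]. *)
Lemma hform_brk Z X Y : Z \in lalg G -> X \in lalg G -> Y \in lalg G ->
  hform G h (brk Z X) Y + hform G h X (brk Z Y) = 0.
Proof.
move=> GZ GX GY.
pose c (X : 'M[R]_N) (s : R) := mexp (s *: Z) *m X *m mexp (- s *: Z).
have dc W : is_mderive (fun s => lcoord G (c W s)) 0 (lcoord G (brk Z W)).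
  apply/is_mderiveP; apply: (@is_derive_linear _ _ _ _ (lcoord G)).
    exact: linear_mx_continuous.
  exact/is_mderiveP/is_mderive_conj.
have c0 W : c W 0 = W by rewrite /c oppr0 scale0r mexp0 mulmx1 mul1mx.
have dT : is_mderive (fun s => (lcoord G (c Y s))^T) 0 (lcoord G (brk Z Y))^T.
  by move=> i j; rewrite mxE; under eq_fun do rewrite mxE; exact: dc.
have /(_ 0 0) D := is_mderive_mulmx (is_mderive_mulmxr h (dc X)) dT.
have := @derive_val _ _ _ _ _ _ _ D.
rewrite !c0 mxE -!hformE => <-.
rewrite (_ : (fun s => _) = cst (hform G h X Y)) ?derive_cst//.
apply/funext => s; rewrite -hformE /c mexpN /=.
by rewrite (hmet_Ad h_metric)//; exact: lgrp_mexp.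
Qed.

(** Invariance makes the adjoint action skew for the metric, whence the minus sign. This turns the
    coadjoint terms of the third equation into brackets. *)
Lemma h_sharp_ad_star X l : X \in lalg G ->
  h_sharp G h (ad_star G X l) = - brk X (h_sharp G h l).
Proof.
move=> GX; set Y := h_sharp G h l.
have GY : Y \in lalg G by exact: h_sharp_lalg.
have lE : l = lcoord G Y *m h.
  by rewrite /Y /h_sharp lcoord_sum mulmxKV// (hmet_nondeg h_metric).
have evalE Z : dual_eval G l Z = hform G h Y Z.
  by rewrite hformE -lE mxE; apply: eq_bigr => i _; rewrite !mxE.
have -> : ad_star G X l = - (lcoord G (brk X Y) *m h).
  apply/rowP => i; rewrite [LHS]mxE evalE [RHS]mxE.
  have <- : hform G h (brk X Y) (tb G i) = (lcoord G (brk X Y) *m h) 0 i.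
    have -> : tb G i = \sum_j (delta_mx 0 i : 'rV_r) 0 j *: tb G j.
      rewrite (bigD1 i)//= mxE !eqxx scale1r big1 ?addr0// => j ji.
      by rewrite mxE (negPf ji) andbF scale0r.
    by rewrite hformE lcoord_sum trmx_delta -colE mxE.
  by apply/eqP; rewrite -addr_eq0 addrC; apply/eqP/hform_brk => //; exact: tb_lalg.
rewrite linearN /= {1}/h_sharp mulmxK ?(hmet_nondeg h_metric)//.
by rewrite -lcoordE//; exact: brk_lalg.
Qed.

End Algebra.

(** * Derivatives on the principal bundle *)

Lemma is_derive_partial1 (R : realType) (U V W : normedModType R)
    (g : U * V -> W) (u v : U) (k : V) :
  differentiable g (u, k) ->
  is_derive u v (fun u => g (u, k)) ('D_(v, 0) g (u, k)).
Proof.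
move=> gd.
have E : (fun h : R => h^-1 *: (g (h *: v + u, k) - g (u, k))) =
    (fun h : R => h^-1 *: (g (h *: (v, 0) + (u, k)) - g (u, k))).
  apply/funext => h; congr (_ *: (g _ - _)).
  by rewrite [RHS]surjective_pairing /= scaler0 add0r.
have : derivable g (u, k) (v, 0) by exact: diff_derivable.
by split; rewrite /derivable /derive E.
Qed.

Lemma derive_pair0_mx (R : realType) (U W : normedModType R) m n
    (g : U * 'M[R]_(m, n) -> W) (p : U * 'M[R]_(m, n)) (X : 'M[R]_(m, n)) :
  differentiable g p ->
  'D_(0, X) g p = \sum_i \sum_j X i j *: 'D_(0, delta_mx i j) g p.
Proof.
move=> gd; rewrite deriveE//.
have -> : (0 : U, X) = \sum_i \sum_j X i j *: (0 : U, delta_mx i j).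
  have pair0D (A B : 'M[R]_(m, n)) : (0 : U, A + B) = (0, A) + (0, B).
    by rewrite [RHS]surjective_pairing /= addr0.
  rewrite {1}(matrix_sum_delta X).
  rewrite (big_morph (fun A => (0 : U, A)) pair0D erefl); apply: eq_bigr => i _.
  rewrite (big_morph (fun A => (0 : U, A)) pair0D erefl); apply: eq_bigr => j _.
  by rewrite [RHS]surjective_pairing /= scaler0.
rewrite linear_sum; apply: eq_bigr => i _; rewrite linear_sum.
by apply: eq_bigr => j _; rewrite linearZ /= deriveE.
Qed.

(** * Horizontal and vertical derivatives in the trivialization *)

Section Bundle.
Variables (R : realType) (n N r : nat) (M : topologicalType)
  (A : smooth_manifold R n M) (gM : pseudo_metric A)
  (G : matrix_lie_group R N r) (P : Type) (B : principal_bundle A G P)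
  (O : set M) (F : adapted_frame gM B O).
Hypothesis O_open : open O.

Definition triv (x : M) (k : 'M[R]_N) : P := pb_act B (frm_sec F x) k.

Lemma proj_triv x k : O x -> lgrp G k -> pb_proj B (triv x k) = x.
Proof. by move=> Ox Gk; rewrite act_proj// (sec_smooth F).1. Qed.

Lemma gpart_triv x k : O x -> lgrp G k -> gpart B (frm_sec F) (triv x k) = k.
Proof.
move=> Ox Gk; rewrite /gpart proj_triv//.
have [Gg] := @getPex _ [set g | lgrp G g /\ triv x k = pb_act B (frm_sec F x) g]
  (ex_intro _ k (conj Gk erefl)).
by move=> E; exact: esym (act_free Gk Gg E).
Qed.

Lemma triv_exists z : O (pb_proj B z) -> exists x k,
  [/\ O x, lgrp G k & z = triv x k].
Proof.
move=> Oz; have [|k Gk zk] := @act_trans _ _ _ _ _ _ _ _ B (frm_sec F (pb_proj B z)) z.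
  by rewrite (sec_smooth F).1.
by exists (pb_proj B z), k; split.
Qed.

Lemma act_triv x k k' : lgrp G k -> lgrp G k' ->
  pb_act B (triv x k) k' = triv x (k *m k').
Proof. by move=> Gk Gk'; rewrite /triv pb_actM. Qed.

Lemma chart_invK x : chart_inv A x (chart A x x) = x.
Proof. by apply: chartK; exact: mem_chart_dom. Qed.

Lemma near_chart_inv x : O x -> \forall u \near chart A x x, O (chart_inv A x u).
Proof.
move=> Ox; have := @chart_inv_continuous _ _ _ A x (chart A x x).
move=> /(_ (ex_intro2 _ _ x (mem_chart_dom A x) erefl)) /(_ O); apply.
by rewrite chart_invK; exact: open_nbhs_nbhs.
Qed.

Lemma dP_horizontal (W : normedModType R) (f : P -> W) x k v :
  O x -> lgrp G k ->
  dP F f (triv x k) (v, 0) = mder A (fun y => f (triv y k)) x v.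
Proof.
move=> Ox Gk; rewrite /dP proj_triv// gpart_triv//.
have vs0 : vsval (0 : subvs_of (lalg G)) = 0 by exact: linear0.
rewrite (_ : (fun s : R => _) = cst (f (triv x k))) ?derive1_cst ?addr0//.
by apply/funext => s; rewrite vs0 scaler0 mexp0 pb_act1.
Qed.

Lemma dP_vertical (W : normedModType R) (f : P -> W) x k X :
  O x -> lgrp G k ->
  dP F f (triv x k) (0, X)
    = derive1 (fun s => f (triv x (k *m mexp (s *: vsval X)))) 0.
Proof.
move=> Ox Gk; rewrite /dP /mder /= derive0 add0r.
congr (derive1 _ 0); apply/funext => s; rewrite act_triv//.
by apply: lgrp_mexp; exact: subvsP.
Qed.

Section SmoothFunction.
Variables (W : normedModType R) (f : P -> W) (x : M).
Hypotheses (f_smooth : psmooth B O f) (Ox : O x).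

Let u0 := chart A x x.

(** [g] extends [f] off the group to an open set of matrices, where ordinary calculus applies. *)
Definition local_rep (k : 'M[R]_N) (D : set ('rV[R]_n * 'M[R]_N))
    (g : 'rV[R]_n * 'M[R]_N -> W) :=
  [/\ open D, D (u0, k), smooth_on D g &
    forall u k', D (u, k') -> lgrp G k' -> f (triv (chart_inv A x u) k') = g (u, k')].

Lemma local_repP k : lgrp G k -> exists D g, local_rep k D g.
Proof.
move=> Gk.
have [D [g [oD Dk sg fg]]] := f_smooth O_open (@subset_refl _ O) (sec_smooth F) Ox Gk.
by exists D, g; split.
Qed.

Lemma local_rep_diff k D g k' : local_rep k D g -> D (u0, k') ->
  differentiable g (u0, k').
Proof. by move=> [_ _ sg _] Dk'; have [/(_ _ Dk')] := sg 1%N. Qed.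

Lemma local_rep_vertical k D g k' X : local_rep k D g -> D (u0, k') ->
  lgrp G k' -> X \in lalg G ->
  is_derive (0 : R) (1 : R) (fun s => f (triv x (k' *m mexp (s *: X))))
    ('D_(0, k' *m X) g (u0, k')).
Proof.
move=> rep Dk' Gk' GX; have [oD _ _ fg] := rep.
pose c (s : R) := (u0, k' *m mexp (s *: X)).
have c0 : c 0 = (u0, k') by rewrite /c scale0r mexp0 mulmx1.
have dc : is_derive (0 : R) (1 : R) c (0, k' *m X).
  apply: is_derive_pair.
  apply/is_mderiveP; have := is_mderive_mulmxl k' (is_mderive_mexp X 0).
  by rewrite scale0r mexp0 mulmx1.
have gd : differentiable g (c 0) by rewrite c0; exact: local_rep_diff rep Dk'.
have := is_derive_comp_curve dc gd; rewrite c0; apply: near_eq_is_derive.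
have cc : {for 0, continuous c}.
  apply: differentiable_continuous; apply/derivable1_diffP.
  exact: (@ex_derive _ _ _ _ _ _ _ dc).
have Dc : \forall s \near (0 : R), D (c s).
  by apply: (cc D); rewrite c0; apply: open_nbhs_nbhs.
near=> s; rewrite /= -fg ?chart_invK//; first exact: (near Dc s).
by apply: grpM => //; exact: lgrp_mexp.
Unshelve. all: by end_near. Qed.

Lemma dP_vertical_rep k D g k' (X : subvs_of (lalg G)) :
  local_rep k D g -> D (u0, k') -> lgrp G k' ->
  dP F f (triv x k') (0, X) = 'D_(0, k' *m vsval X) g (u0, k').
Proof.
move=> rep Dk' Gk'; rewrite dP_vertical// derive1E.
exact: (@derive_val _ _ _ _ _ _ _ (local_rep_vertical rep Dk' Gk' (subvsP X))).
Qed.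

(** The one-parameter group law moves the base point to [k *m mexp (s *: vsval X)] and so reduces
    time [s] to time 0. *)
Lemma is_derive_vertical k (X : subvs_of (lalg G)) (s : R) : lgrp G k ->
  is_derive s (1 : R) (fun s => f (triv x (k *m mexp (s *: vsval X))))
    (dP F f (triv x (k *m mexp (s *: vsval X))) (0, X)).
Proof.
move=> Gk; set k' := k *m mexp (s *: vsval X).
have Gk' : lgrp G k' by apply: grpM => //; apply: lgrp_mexp; exact: subvsP.
apply: is_derive_from0; under eq_fun do rewrite mexpD mulmxA.
have [D [g rep]] := local_repP Gk'; have [_ Dk' _ _] := rep.
rewrite (dP_vertical_rep X rep)//.
exact: local_rep_vertical rep Dk' Gk' (subvsP X).
Qed.

Lemma near_local_rep k D g : local_rep k D g -> \forall k' \near k, D (u0, k').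
Proof.
move=> [oD Dk _ _].
have := open_nbhs_nbhs (conj oD Dk) => -[[U V] /= [Uu Vk] UV].
by apply: filterS Vk => k' Vk'; apply: (UV (u0, k')); split=> //=; exact: nbhs_singleton.
Qed.

Lemma cvg_pair_mx (k : 'M[R]_N) :
  (fun k' : 'M[R]_N => (u0, k')) @ k --> (u0, k).
Proof.
move=> S [[U V] /= [Uu Vk] UV]; apply: (@filterS _ (nbhs k) _ V) => // k' Vk'.
by apply: (UV (u0, k')); split=> //=; exact: nbhs_singleton.
Qed.

Lemma continuous_triv : {within lgrp G, continuous (fun k => f (triv x k))}.
Proof.
apply/subspace_continuousP => k Gk; have [D [g rep]] := local_repP Gk.
have [_ Dk _ fg] := rep; have gk := differentiable_continuous (local_rep_diff rep Dk).
have fgE k' : D (u0, k') -> lgrp G k' -> f (triv x k') = g (u0, k').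
  by move=> /fg + /[dup] Gk' => /(_ Gk'); rewrite chart_invK.
change ((fun k => f (triv x k)) @ within (lgrp G) (nbhs k) --> f (triv x k)).
rewrite fgE//.
have FG : Filter (within (lgrp G) (nbhs k)) by exact: within_filter.
suff : (fun k' => g (u0, k')) @ within (lgrp G) (nbhs k) --> g (u0, k).
  apply: cvg_trans; apply: near_eq_cvg; near=> k' => /=; rewrite fgE//.
    by near: k'; apply: cvg_within; exact: near_local_rep rep.
  by near: k'; exact: withinT.
have kk : (fun k' : 'M[R]_N => (u0, k')) @ within (lgrp G) (nbhs k) --> (u0, k).
  by apply: cvg_within_filter; exact: cvg_pair_mx.
exact: (@cvg_comp _ _ _ _ g _ _ _ kk gk).
Unshelve. all: by end_near. Qed.

(** Smoothness gives continuity of ['D_v g] for a fixed [v], but the direction [k' *m vsval X] moves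
    with [k']. It is therefore expanded in elementary matrices, with coefficients continuous in
    [k']. *)
Lemma continuous_dP_vertical (X : subvs_of (lalg G)) :
  {within lgrp G, continuous (fun k => dP F f (triv x k) (0, X))}.
Proof.
apply/subspace_continuousP => k Gk; have [D [g rep]] := local_repP Gk.
have [_ Dk sg fg] := rep.
have dPE k' : D (u0, k') -> lgrp G k' -> dP F f (triv x k') (0, X) =
    \sum_i \sum_j (k' *m vsval X) i j *: 'D_(0, delta_mx i j) g (u0, k').
  move=> Dk' Gk'; rewrite (dP_vertical_rep X rep)// derive_pair0_mx//.
  exact: local_rep_diff rep Dk'.
change ((fun k => dP F f (triv x k) (0, X)) @ within (lgrp G) (nbhs k) -->
  dP F f (triv x k) (0, X)).
rewrite dPE//.
have FG : Filter (within (lgrp G) (nbhs k)) by exact: within_filter.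
suff : (\sum_i \sum_j (k' *m vsval X) i j *: 'D_(0, delta_mx i j) g (u0, k'))
    @[k' --> within (lgrp G) (nbhs k)] -->
    \sum_i \sum_j (k *m vsval X) i j *: 'D_(0, delta_mx i j) g (u0, k).
  apply: cvg_trans; apply: near_eq_cvg; near=> k' => /=; rewrite dPE//.
    by near: k'; apply: cvg_within; exact: near_local_rep rep.
  by near: k'; exact: withinT.
have kG : (fun k' => k') @ within (lgrp G) (nbhs k) --> k by exact: cvg_within.
apply: cvg_big => [|i _]; first exact: add_continuous.
apply: cvg_big => [|j _]; first exact: add_continuous.
apply: cvgZ.
  have kX : (fun k' => k' *m vsval X) @ within (lgrp G) (nbhs k) --> k *m vsval X.
    exact: (cvg_mulmx kG (cvg_cst (vsval X))).
  by move/cvg_mxP : kX; exact.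
have [_ /(_ (0, delta_mx i j) _ Dk) gc] := sg 1%N.
have kk : (fun k' : 'M[R]_N => (u0, k')) @ within (lgrp G) (nbhs k) --> (u0, k).
  by apply: cvg_within_filter; exact: cvg_pair_mx.
exact: (@cvg_comp _ _ _ _ ('D_(0, delta_mx i j) g) _ _ _ kk gc).
Unshelve. all: by end_near. Qed.

Lemma derivable_horizontal k v : lgrp G k ->
  derivable ((fun y => f (triv y k)) \o chart_inv A x) u0 v.
Proof.
move=> Gk; have [D [g rep]] := local_repP Gk; have [oD Dk _ fg] := rep.
have gd := is_derive_partial1 v (local_rep_diff rep Dk).
apply: near_eq_derivable (@ex_derive _ _ _ _ _ _ _ gd).
have := open_nbhs_nbhs (conj oD Dk) => -[[U V] /= [Uu Vk] UV].
near=> u; rewrite /= fg//; apply: (UV (u, k)); split=> /=.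
  exact: (near Uu u).
exact: nbhs_singleton.
Unshelve. all: by end_near. Qed.

(* The base point may move within the fibre: applied to k' = k and L = h^*, and
   to k' = k e^{s t_j} and L = Ad. *)
Lemma dP_horizontal_linear (W' : normedModType R) (L : {linear W -> W'})
    (f' : P -> W') k k' v : continuous L -> lgrp G k -> lgrp G k' ->
  (forall y, O y -> f' (triv y k') = L (f (triv y k))) ->
  dP F f' (triv x k') (v, 0) = L (dP F f (triv x k) (v, 0)).
Proof.
move=> cL Gk Gk' fL; rewrite !dP_horizontal// /mder.
have D := is_derive_linear cL (derivableP (@derivable_horizontal k v Gk)).
rewrite -[RHS](@derive_val _ _ _ _ _ _ _ D).
apply: near_eq_derive; near=> u; rewrite /= fL//.
by near: u; exact: near_chart_inv.
Unshelve. all: by end_near. Qed.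

End SmoothFunction.
End Bundle.

(** * The Yang-Mills equations *)

(** The adjoint action of the inverse, which is how an equivariant field transforms under the right
    action. *)
Definition Ad_inv (R : realType) (N : nat) (g Y : 'M[R]_N) := invmx g *m Y *m g.

Lemma Ad_inv_is_linear (R : realType) (N : nat) (g : 'M[R]_N) : linear (Ad_inv g).
Proof.
by move=> c Y Z; rewrite /Ad_inv mulmxDr mulmxDl -scalemxAr -scalemxAl.
Qed.

HB.instance Definition _ (R : realType) (N : nat) (g : 'M[R]_N) :=
  GRing.isLinear.Build _ _ _ _ (Ad_inv g) (Ad_inv_is_linear g).

Lemma Ad_inv_brk (R : realType) (N : nat) (g Y Z : 'M[R]_N) : g \in unitmx ->
  Ad_inv g (brk Y Z) = brk (Ad_inv g Y) (Ad_inv g Z).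
Proof.
by move=> ug; rewrite /brk linearB /= /Ad_inv !mulmxA !(mulmxK ug).
Qed.

Lemma transvect2_diag (R : realType) (n : nat) (S : 'M[R]_n) (P : Type)
    (W : normedModType R) (T : 'I_n -> 'I_n -> P -> W) a b z :
  (forall a b, a != b -> S a b = 0) ->
  transvect2 S T a b z = (S a a * S b b) *: T a b z.
Proof.
move=> S0; rewrite /transvect2 (bigD1 a)//= [X in _ + X]big1 => [|c ca].
  rewrite addr0 (bigD1 b)//= big1 ?addr0// => d db.
  by rewrite [S b d]S0 1?eq_sym// mulr0 scale0r.
by rewrite big1// => d _; rewrite [S a c]S0 1?eq_sym// mul0r scale0r.
Qed.

Lemma invmx_mul (R : realType) (N : nat) (g k : 'M[R]_N) :
  g \in unitmx -> k \in unitmx -> invmx (g *m k) = invmx k *m invmx g.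
Proof.
move=> ug uk; have ugk : g *m k \in unitmx by rewrite unitmx_mul ug.
apply: (can_inj (mulKmx ugk)); rewrite mulmxV// -mulmxA (mulmxA k) mulmxV//.
by rewrite mul1mx mulmxV.
Qed.

(** * Equivariance and vanishing of the Yang-Mills residue *)

Section YangMills.
Variables (R : realType) (n N r : nat) (M : topologicalType)
  (A : smooth_manifold R n M) (gM : pseudo_metric A)
  (G : matrix_lie_group R N r) (P : Type) (B : principal_bundle A G P)
  (O : set M) (F : adapted_frame gM B O)
  (om : 'I_n -> 'I_n -> M -> {scalar 'rV[R]_n}).
Hypothesis O_open : open O.
Local Notation triv := (triv F).

Lemma covD1_horizontal (W : normedModType R) (u : 'I_n -> P -> W) b a x k :
  O x -> lgrp G k ->
  covD1 F om u b a (triv x k) = dP F (u b) (triv x k) (frm F a x, 0)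
    - \sum_c om c b x (frm F a x) *: u c (triv x k).
Proof. by move=> Ox Gk; rewrite /covD1 /pullP /eP proj_triv. Qed.

Lemma covD2_horizontal (W : normedModType R) (T : 'I_n -> 'I_n -> P -> W)
    a b c x k : O x -> lgrp G k ->
  covD2 F om T a b c (triv x k) = dP F (T a b) (triv x k) (frm F c x, 0)
    + \sum_d om a d x (frm F c x) *: T d b (triv x k)
    + \sum_d om b d x (frm F c x) *: T a d (triv x k).
Proof. by move=> Ox Gk; rewrite /covD2 /pullP /eP proj_triv. Qed.

(** The frame and connection forms depend on the base point only, so a fixed linear map of the
    values passes through the covariant derivative even when [k] changes to [k']. *)
Lemma covD1_linear (W W' : normedModType R) (L : {linear W -> W'})
    (u : 'I_n -> P -> W) (u' : 'I_n -> P -> W') b a x k k' :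
  continuous L -> (forall c, psmooth B O (u c)) -> O x -> lgrp G k -> lgrp G k' ->
  (forall c y, O y -> u' c (triv y k') = L (u c (triv y k))) ->
  covD1 F om u' b a (triv x k') = L (covD1 F om u b a (triv x k)).
Proof.
move=> cL us Ox Gk Gk' uL; rewrite !covD1_horizontal// linearB/=; congr (_ - _).
  exact: (dP_horizontal_linear O_open (us b) Ox (frm F a x) cL Gk Gk' (uL b)).
by rewrite linear_sum; apply: eq_bigr => c _; rewrite linearZ uL.
Qed.

Lemma covD2_linear (W W' : normedModType R) (L : {linear W -> W'})
    (T : 'I_n -> 'I_n -> P -> W) (T' : 'I_n -> 'I_n -> P -> W') a b c x k k' :
  continuous L -> (forall a b, psmooth B O (T a b)) -> O x ->
  lgrp G k -> lgrp G k' ->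
  (forall a b y, O y -> T' a b (triv y k') = L (T a b (triv y k))) ->
  covD2 F om T' a b c (triv x k') = L (covD2 F om T a b c (triv x k)).
Proof.
move=> cL Ts Ox Gk Gk' TL; rewrite !covD2_horizontal// 2!linearD !linear_sum.
congr (_ + _ + _); first exact:
  (dP_horizontal_linear O_open (Ts a b) Ox (frm F c x) cL Gk Gk' (TL a b)).
  by apply: eq_bigr => d _; rewrite linearZ TL.
by apply: eq_bigr => d _; rewrite linearZ TL.
Qed.

(** The matrix is diagonal with entries 1 or -1. Being its own inverse, it serves both to raise and
    to lower indices. *)
Lemma gconst_mulmx : gconst F *m gconst F = 1%:M.
Proof.
apply/matrixP => a b; rewrite !mxE (bigD1 a)//= big1 => [|c ca].
  have [<-|ab] := eqVneq a b.
    by rewrite addr0; case: (gconst_diag F a) => ->; rewrite ?mulrNN mulr1.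
  by rewrite [gconst F a b]gconst_offdiag// mulr0 addr0.
by rewrite [gconst F a c]gconst_offdiag 1?eq_sym// mul0r.
Qed.

Lemma raise2_lower2 (W W' : normedModType R) (L : {linear W -> W'})
    (T : 'I_n -> 'I_n -> P -> W) (T' : 'I_n -> 'I_n -> P -> W') z :
  (forall a b, T' a b z = L (lower2 (gconst F) T a b z)) ->
  forall a b, raise2 (gconst F) T' a b z = L (T a b z).
Proof.
move=> TL a b; have gg := gconst_mulmx.
have ginv : invmx (gconst F) = gconst F.
  by have [ug _] := mulmx1_unit gg; rewrite -[LHS]mulmx1 -gg mulKmx.
have g1 c : gconst F c c * gconst F c c = 1.
  by case: (gconst_diag F c) => ->; rewrite ?mulrNN mulr1.
have off : forall a b, a != b -> gconst F a b = 0 by exact: gconst_offdiag.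
rewrite /raise2 ginv transvect2_diag// TL /lower2 transvect2_diag// linearZ.
by rewrite scalerA mulrACA !g1 mulr1 scale1r.
Qed.

Variables (h : 'M[R]_r) (h_metric : Ad_invariant_metric G h).
Variable eta : lie_1form n G P.
Hypotheses (eta_smooth : smooth_1form F eta)
  (G_unimodular : unimodular G) (G_compact : compact (lgrp G)).
Variables (p : 'I_n -> 'I_n -> P -> 'rV[R]_r) (q : 'I_n -> 'I_r -> P -> 'rV[R]_r).
Hypotheses (p_smooth : forall a b, psmooth B O (p a b))
  (q_smooth : forall a j, psmooth B O (q a j)).
Hypothesis eq1 : forall a b z, O (pb_proj B z) ->
  curv F om eta a b z = h_sharp G h (lower2 (gconst F) p a b z).
Hypothesis eq2 : forall a j z, O (pb_proj B z) ->
  dP F (form_comp F eta a) z (rhoP n G j) + brk (tb G j) (form_comp F eta a z) = 0.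
Hypothesis eq3 : forall a z, O (pb_proj B z) ->
  \sum_b (covD2 F om p a b b z - ad_star G (form_comp F eta b z) (p a b z))
  + \sum_j (dP F (q a j) z (rhoP n G j) - ad_star G (tb G j) (q a j z)
            - \tr (ad_mx G (tb G j)) *: q a j z) = 0.

Let F2 := raise2 (gconst F) (curv F om eta).

Definition ym_residue a z : 'M[R]_N :=
  \sum_b (covD2 F om F2 a b b z + brk (form_comp F eta b z) (F2 a b z)).

Local Notation fl j s := (mexp (s *: tb G j)).

Lemma vsval_tb j : vsval (vsproj (lalg G) (tb G j)) = tb G j.
Proof. by apply: vsprojK; exact: tb_lalg. Qed.

Lemma lgrp_fl j (s : R) : lgrp G (fl j s).
Proof. by apply: lgrp_mexp; exact: tb_lalg. Qed.

(** The second equation reads [f' = - brk X f] along the flow of [X], so conjugating [f] by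
    [mexp (t *: X)] gives a constant. *)
Lemma form_comp_equivariant a x k j (s : R) : O x -> lgrp G k ->
  form_comp F eta a (triv x (k *m fl j s))
    = Ad_inv (fl j s) (form_comp F eta a (triv x k)).
Proof.
move=> Ox Gk; set f := form_comp F eta a; set X := tb G j.
have df t : is_mderive (fun t => f (triv x (k *m mexp (t *: X)))) t
    (- brk X (f (triv x (k *m mexp (t *: X))))).
  apply/is_mderiveP.
  have := is_derive_vertical F O_open (eta_smooth.1 a) Ox (vsproj (lalg G) X) t Gk.
  rewrite vsval_tb -/(fundP n _) -/(rhoP n G j) => /is_derive_eq; apply.
  apply/eqP; rewrite -addr_eq0; apply/eqP/eq2.
  by rewrite proj_triv//; apply: grpM => //; exact: lgrp_fl.
have cst t : is_mderive (fun t => mexp (t *: X) *m f (triv x (k *m mexp (t *: X)))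
    *m mexp (- t *: X)) t 0.
  have := is_mderive_mulmx (is_mderive_mulmx (is_mderive_mexp X t) (df t))
    (is_mderive_mexpN X t).
  congr is_mderive; rewrite (mexp_comm X t) /brk opprB mulmxBr !mulmxA.
  by rewrite [_ + (_ - _)]addrC subrK mulmxN !mulmxA subrr.
have := is_mderive0_cst cst s 0.
rewrite oppr0 scale0r mexp0 !mulmx1 mul1mx => <-.
have ue : mexp (s *: X) \in unitmx by apply: grp_unit; exact: lgrp_fl.
by rewrite /Ad_inv mexpN !mulmxA mulVmx// mul1mx mulmxKV.
Qed.

Lemma curv_equivariant a b x k j (s : R) : O x -> lgrp G k ->
  curv F om eta a b (triv x (k *m fl j s))
    = Ad_inv (fl j s) (curv F om eta a b (triv x k)).
Proof.
move=> Ox Gk; have Ge := lgrp_fl j s; have Gke := grpM Gk Ge.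
rewrite /curv [RHS](linearD (Ad_inv (fl j s))) (linearB (Ad_inv (fl j s))).
rewrite /= Ad_inv_brk ?(grp_unit Ge)//.
have eqv c y (Oy : O y) := form_comp_equivariant c j s Oy Gk.
have cAd : continuous (Ad_inv (fl j s)) by exact: linear_mx_continuous.
rewrite !(covD1_linear _ _ cAd eta_smooth.1 Ox Gk Gke eqv).
by rewrite !form_comp_equivariant.
Qed.

Lemma F2E a b z : O (pb_proj B z) -> F2 a b z = h_sharp G h (p a b z).
Proof.
by move=> Oz; apply: (@raise2_lower2 _ _ (h_sharp G h)) => c d; exact: eq1.
Qed.

Lemma F2_equivariant a b x k j (s : R) : O x -> lgrp G k ->
  F2 a b (triv x (k *m fl j s)) = Ad_inv (fl j s) (F2 a b (triv x k)).
Proof.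
move=> Ox Gk; rewrite /F2 /raise2 /transvect2 linear_sum; apply: eq_bigr => c _.
by rewrite linear_sum; apply: eq_bigr => d _; rewrite linearZ curv_equivariant.
Qed.

Lemma covD2_F2 a b c x k : O x -> lgrp G k ->
  covD2 F om F2 a b c (triv x k) = h_sharp G h (covD2 F om p a b c (triv x k)).
Proof.
move=> Ox Gk; apply: covD2_linear => //; first exact: linear_mx_continuous.
by move=> d e y Oy; rewrite F2E// proj_triv.
Qed.

(** Covariant derivatives of [F2] are obtained from those of [p], whose smoothness is given, through
    the linear map [Ad_inv] composed with [h_sharp]. *)
Lemma ym_residue_equivariant a x k j (s : R) : O x -> lgrp G k ->
  ym_residue a (triv x (k *m fl j s)) = Ad_inv (fl j s) (ym_residue a (triv x k)).
Proof.
move=> Ox Gk; have Ge := lgrp_fl j s; have Gke := grpM Gk Ge.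
rewrite /ym_residue linear_sum; apply: eq_bigr => b _.
rewrite (linearD (Ad_inv (fl j s))) /= Ad_inv_brk ?(grp_unit Ge)// -F2_equivariant//.
rewrite -form_comp_equivariant//; congr (_ + _); rewrite (covD2_F2 _ _ _ Ox Gk).
pose L : {linear 'rV[R]_r -> 'M[R]_N} := Ad_inv (fl j s) \o h_sharp G h.
change (covD2 F om F2 a b b (triv x (k *m fl j s)) = L (covD2 F om p a b b (triv x k))).
apply: (covD2_linear _ _ _ _ p_smooth Ox Gk Gke); first exact: linear_mx_continuous.
by move=> c d y Oy; rewrite F2_equivariant// F2E// proj_triv.
Qed.

(** Image of the third equation under [h_sharp]: coadjoint terms become brackets of opposite sign,
    and unimodularity removes the trace term. *)
Lemma ym_residue_divergence a x k : O x -> lgrp G k ->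
  ym_residue a (triv x k) = - \sum_j
    (h_sharp G h (dP F (q a j) (triv x k) (rhoP n G j))
     + brk (tb G j) (h_sharp G h (q a j (triv x k)))).
Proof.
move=> Ox Gk; set z := triv x k.
have Oz : O (pb_proj B z) by rewrite proj_triv.
apply/eqP; rewrite -addr_eq0; apply/eqP.
rewrite -[RHS](linear0 (h_sharp G h)) -(eq3 a Oz) linearD !linear_sum/=.
congr (_ + _); apply: eq_bigr => i _.
  rewrite linearB /= h_sharp_ad_star//; last exact: subvsP.
  by rewrite opprK covD2_F2// F2E.
rewrite !linearB /= h_sharp_ad_star//; last exact: tb_lalg.
by rewrite G_unimodular ?tb_lalg// scale0r linear0 subr0 opprK.
Qed.

Lemma ym_residue_eq0 a z : O (pb_proj B z) -> ym_residue a z = 0.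
Proof.
move=> Oz; have [x [k0 [Ox Gk0 ->]]] := triv_exists F Oz.
(* The residue transported by [Ad_k]; equivariance makes it invariant under right multiplication by
   the flows. *)
pose C k := k *m ym_residue a (triv x k) *m invmx k.
have Cfl k j s : lgrp G k -> C (k *m fl j s) = C k.
  move=> Gk; rewrite /C ym_residue_equivariant// /Ad_inv.
  have uk := grp_unit Gk; have ue := grp_unit (lgrp_fl j s).
  by rewrite invmx_mul// !mulmxA !mulmxK.
(* Invariance of [C] is known along one-parameter groups only, and the group may be disconnected.
   The averages are therefore taken over the subgroup of all right translations preserving [C]. *)
pose H : set 'M[R]_N := [set k | lgrp G k /\ forall g, lgrp G g -> C (g *m k) = C g].
have H1 : H 1%:M by split=> [|g _]; [exact: grp1|rewrite mulmx1].
have HM g k : H g -> H k -> H (g *m k).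
  move=> [Gg Cg] [Gk Ck]; split=> [|l Gl]; first exact: grpM.
  by rewrite mulmxA Ck ?Cg//; exact: grpM.
have HV g : H g -> H (invmx g).
  move=> [Gg Cg]; split=> [|l Gl]; first exact: grpV.
  by rewrite -[LHS]Cg ?mulmxKV ?(grp_unit Gg)//; apply: grpM => //; exact: grpV.
have HU g : H g -> g \in unitmx by move=> [/grp_unit].
have Hfl j s : H (fl j s) by split=> [|g Gg]; [exact: lgrp_fl|exact: Cfl].
pose Y j k := h_sharp G h (q a j (triv x k)).
pose Y' j k := h_sharp G h (dP F (q a j) (triv x k) (rhoP n G j)) + brk (tb G j) (Y j k).
pose Q j k := k *m Y j k *m invmx k.
pose D j k := k *m Y' j k *m invmx k.
have CD k : lgrp G k -> \sum_j D j k = - C k.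
  move=> Gk; rewrite /C ym_residue_divergence// mulmxN mulNmx opprK.
  by rewrite mulmx_sumr mulmx_suml.
have sub : H `<=` lgrp G by move=> g [].
have cconj (Z : 'M[R]_N -> 'M[R]_N) i l : {within lgrp G, continuous Z} ->
    {within lgrp G, continuous (fun k => (k *m Z k *m invmx k) i l)}.
  move=> /subspace_continuousP cZ; apply/subspace_continuousP => k Gk.
  have kk : id @ within (lgrp G) (nbhs k) --> k by exact: cvg_within.
  have kV : invmx k' @[k' --> within (lgrp G) (nbhs k)] --> invmx k.
    apply: cvg_invmx kk; first exact: grp_unit Gk.
    by near=> k'; apply: (@grp_unit _ _ _ G); near: k'; exact: withinT.
  have FG : Filter (within (lgrp G) (nbhs k)) by exact: within_filter.
  have kZ : k' *m Z k' *m invmx k' @[k' --> within (lgrp G) (nbhs k)]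
      --> k *m Z k *m invmx k.
    exact: (cvg_mulmx (cvg_mulmx kk (cZ _ Gk)) kV).
  by move/cvg_mxP : kZ; exact.
have net (Z : 'M[R]_N -> 'M[R]_N) i l (e : R) : {within lgrp G, continuous Z} ->
    0 < e -> exists V, translate_net H V e
      (fun k => (k0 *m k *m Z (k0 *m k) *m invmx (k0 *m k)) i l).
  move=> cZ e0.
  have [V fV] := compact_translate_net G_compact sub (@grpM _ _ _ G) (cconj Z i l cZ) e0.
  by exists V; exact: fV.
have cY j : {within lgrp G, continuous (Y j)}.
  apply/subspace_continuousP => k Gk.
  have /subspace_continuousP/(_ k Gk) cq := continuous_triv (F := F) O_open (q_smooth a j) Ox.
  by apply: (cvg_comp _ _ cq); exact: (@linear_mx_continuous _ _ _ _ (h_sharp G h)).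
have cY' j : {within lgrp G, continuous (Y' j)}.
  apply/subspace_continuousP => k Gk.
  have /subspace_continuousP/(_ k Gk) cq :=
    continuous_dP_vertical (F := F) (X := vsproj (lalg G) (tb G j)) O_open
      (q_smooth a j) Ox.
  have /subspace_continuousP/(_ k Gk) cYk := cY j.
  apply: cvgD.
    by apply: (cvg_comp _ _ cq); exact: (@linear_mx_continuous _ _ _ _ (h_sharp G h)).
  apply: cvgB; [exact: (cvg_mulmx (cvg_cst _) cYk)|exact: (cvg_mulmx cYk (cvg_cst _))].
(* Differentiating the two conjugating factors produces the bracket with [tb G j], which is the
   second term of [Y']. *)
have dQ j k s : lgrp G k ->
    is_mderive (fun s => Q j (k *m fl j s)) s (D j (k *m fl j s)).
  move=> Gk; have uk := grp_unit Gk; set X := tb G j.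
  have dY : is_mderive (fun s => Y j (k *m mexp (s *: X))) s
      (h_sharp G h (dP F (q a j) (triv x (k *m mexp (s *: X))) (rhoP n G j))).
    have := is_derive_vertical F O_open (q_smooth a j) Ox (vsproj (lalg G) X) s Gk.
    rewrite vsval_tb => dq; apply/is_mderiveP.
    pose L : {linear 'rV[R]_r -> 'M[R]_N} := h_sharp G h.
    have cL : continuous L by exact: linear_mx_continuous.
    exact: (is_derive_linear cL dq).
  have -> : (fun s => Q j (k *m mexp (s *: X))) = fun s =>
      k *m mexp (s *: X) *m Y j (k *m mexp (s *: X)) *m (mexp (- s *: X) *m invmx k).
    apply/funext => t; rewrite /Q invmx_mul//; first by rewrite mexpN.
    by apply: grp_unit; exact: lgrp_fl.
  have := is_mderive_mulmx (is_mderive_mulmx (is_mderive_mulmxl k (is_mderive_mexp X s)) dY)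
    (is_mderive_mulmxr (invmx k) (is_mderive_mexpN X s)).
  congr is_mderive; rewrite /D /Y' invmx_mul//; last first.
    by apply: grp_unit; exact: lgrp_fl.
  rewrite -/X -mexpN (mexp_comm X s) /brk !(mulmxDr, mulmxDl, mulmxN, mulNmx) !mulmxA.
  by rewrite [RHS]addrA; congr (_ - _); rewrite addrC.
suff C0 : C k0 = 0.
  have := C0; rewrite /C => /(congr1 (fun Z => invmx k0 *m Z *m k0)).
  have uk := grp_unit Gk0.
  by rewrite !mulmxA mulVmx// mul1mx mulmxKV// mulmx0 mul0mx.
apply/matrixP => i l; rewrite [RHS]mxE; apply/eqP; rewrite -oppr_eq0; apply/eqP.
(* Each entry is treated on the coset of [k0] under [H], where the sum of the [D j] stays equal to
   [- C k0]. *)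
apply: (@constant_divergence_eq0 _ _ r H H1 HM HV HU (fun j s => fl j s)
  (fun j k => D j (k0 *m k) i l) (fun j k => Q j (k0 *m k) i l)) => //.
- move=> j k s [Gk _]; rewrite mulmxA; under eq_fun do rewrite mulmxA.
  exact: dQ (grpM Gk0 Gk) i l.
(* A net for any one error, here 1, already gives boundedness. *)
- move=> j; have [V QV] := net (Y j) i l 1 (cY j) ltr01.
  exact: translate_net_bounded QV.
- by move=> j e e0; exact: net.
- move=> k [Gk Ck]; rewrite -summxE -(Ck _ Gk0) CD ?mxE//; exact: grpM.
Unshelve. all: by end_near. Qed.

End YangMills.

Theorem theorem4p1 (R : realType) (n N r : nat) (M : topologicalType)
    (A : smooth_manifold R n M) (gM : pseudo_metric A)
    (G : matrix_lie_group R N r) (h : 'M[R]_r)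
    (h_metric : Ad_invariant_metric G h)
    (P : Type) (B : principal_bundle A G P)
    (O : set M) (O_open : open O) (F : adapted_frame gM B O)
    (om : 'I_n -> 'I_n -> M -> {scalar 'rV[R]_n})
    (om_LC : connection_forms F om)
    (G_unimodular : unimodular G)
    (G_compact : compact (lgrp G))
    (eta : lie_1form n G P)
    (eta_smooth : smooth_1form F eta)
    (eta_normalized : normalized B O eta)
    (p : 'I_n -> 'I_n -> P -> 'rV[R]_r)
    (q : 'I_n -> 'I_r -> P -> 'rV[R]_r)
    (p_smooth : forall a b, psmooth B O (p a b))
    (q_smooth : forall a j, psmooth B O (q a j))
    (p_antisym : forall a b z, O (pb_proj B z) -> p a b z = - p b a z)
    (eq1 : forall a b z, O (pb_proj B z) ->
       covD1 F om (form_comp F eta) b a z - covD1 F om (form_comp F eta) a b z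
       + brk (form_comp F eta a z) (form_comp F eta b z)
       = h_sharp G h (lower2 (gconst F) p a b z))
    (eq2 : forall a j z, O (pb_proj B z) ->
       dP F (form_comp F eta a) z (rhoP n G j)
       + brk (tb G j) (form_comp F eta a z) = 0)
    (eq3 : forall a z, O (pb_proj B z) ->
       \sum_b (covD2 F om p a b b z - ad_star G (form_comp F eta b z) (p a b z))
       + \sum_j (dP F (q a j) z (rhoP n G j)
                 - ad_star G (tb G j) (q a j z)
                 - \tr (ad_mx G (tb G j)) *: q a j z) = 0) :
  forall a z, O (pb_proj B z) ->
    \sum_b (covD2 F om (raise2 (gconst F) (curv F om eta)) a b b z
            + brk (form_comp F eta b z)
                  (raise2 (gconst F) (curv F om eta) a b z)) = 0.
Proof.
move=> a z Oz.
exact: (ym_residue_eq0 O_open h_metric eta_smooth G_unimodular G_compact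
  p_smooth q_smooth eq1 eq2 eq3 a Oz).
Qed.
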